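(* Consider the hierarchical composition $$\dot x_1=f_1(x_1),\qquad\dot x_2=f_2(x_1,x_2)$$ on $K$. Suppose that for each fixed $x_1$, $f_2$ is transverse contracting with metric $M_2(x_2,x_1)$, i.e. for some $\lambda_2>0$ $$\delta_2'\Big(F_{22}'M_2+M_2F_{22}+\tfrac{\partial M_2}{\partial x_2}f_2+\lambda_2M_2\Big)\delta_2\le0$$ for all $\delta_2$ satisfying $\delta_2'M_2f_2=0$, and that $f_1$ is strongly contracting, i.e. there exist $M_1(x_1)$ and $\lambda_1>0$ such that $$F_1'M_1+M_1F_1+\tfrac{\partial M_1}{\partial x_1}f_1+\lambda_1M_1\le0.$$ Then the composed system is transverse contracting, and hence has a unique stable limit cycle.
   Context: A prime denotes transpose; matrix inequalities are in the sense of semidefiniteness. $f_1,f_2$ are smooth, $F_1=\frac{\partial f_1}{\partial x_1}$, $F_{22}=\frac{\partial f_2}{\partial x_2}$; $M_1$, $M_2$ are smooth symmetric positive-definite matrix functions, and $\frac{\partial M_i}{\partial x_i}f_i$ denotes the directional derivative $\sum_j\frac{\partial M_i}{\partial (x_i)_j}(f_i)_j$. The standing setting is that the state $x=(x_1,x_2)$ lies in a compact, smoothly path-connected set $K$ (any two points are joined by a smooth path in $K$) that is strictly forward invariant for the composed system (solutions starting in $K$ are in the interior of $K$ for all $t>0$); the hypotheses hold for all $(x_1,x_2)\in K$. A system $\dot x=f(x)$ with Jacobian $A(x)=\frac{\partial f}{\partial x}$ is transverse contracting if there exist $\lambda>0$ and a smooth symmetric positive-definite $M(x)$ such that $\delta'(A'M+MA+\dot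 M+\lambda M)\delta\le0$ for all $\delta$ with $\delta'M(x)f(x)=0$, where $\dot M$ is the derivative of $M$ along the system. ''Unique stable limit cycle'' means that there is a unique periodic orbit in $K$ (possibly trivial, i.e. an equilibrium), it is orbitally stable, and all solutions starting in $K$ converge to it. *)

(* Defs.v *)
From mathcomp Require Import all_boot all_order all_algebra.
From mathcomp Require Import boolp classical_sets functions reals topology
  normedtype derive.

Set Implicit Arguments.
Unset Strict Implicit.
Unset Printing Implicit Defensive.
Import Order.TTheory GRing.Theory Num.Theory.
Import numFieldNormedType.Exports.

Local Open Scope classical_set_scope.
Local Open Scope ring_scope.

(* For a finite-dimensional [V] and an open [U], this is the usual C^k: all
   iterated directional derivatives up to order [k] exist and are continuous
   on [U]. *)
Fixpoint Ck_on {R : realType} {V W : normedModType R} (U : set V) (k : nat)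
    (f : V -> W) : Prop :=
  if k is k'.+1 then
    (forall x, U x -> differentiable f x) /\
    (forall v : V, Ck_on U k' (fun x => 'D_v f x))
  else forall x, U x -> {for x, continuous f}.

Definition smooth_near {R : realType} {V W : normedModType R} (D : set V)
    (f : V -> W) : Prop :=
  exists U : set V, [/\ open U, D `<=` U & forall k, Ck_on U k f].

Section Contraction.
Context {R : realType} {n : nat}.
Implicit Types (f : 'rV[R]_n -> 'rV[R]_n) (M : 'rV[R]_n -> 'M[R]_n).
Implicit Types (K : set 'rV[R]_n) (d x : 'rV[R]_n) (Q : 'M[R]_n).

(* Points and tangent vectors are row vectors: the number written
   [delta' Q delta] for a column vector [delta] is [d *m Q *m d^T]. *)
Definition qform Q d : R := (d *m Q *m d^T) 0 0.

Definition posdef Q : Prop :=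
  Q^T = Q /\ forall d, d != 0 -> 0 < qform Q d.

Definition metric_on K M : Prop :=
  smooth_near K M /\ forall x, K x -> posdef (M x).

(* ['J f x] acts on row vectors from the right, so the matrix [df_i/dx_j] is
   its transpose. *)
Definition jac f x : 'M[R]_n := ('J f x)^T.

Definition contraction_mx f M (lambda : R) x : 'M[R]_n :=
  (jac f x)^T *m M x + M x *m jac f x + 'D_(f x) M x + lambda *: M x.

Definition contraction_at f M (lambda : R) x : Prop :=
  forall d, qform (contraction_mx f M lambda x) d <= 0.

Definition transverse_contraction_at f M (lambda : R) x : Prop :=
  forall d, (d *m M x *m (f x)^T) 0 0 = 0 ->
    qform (contraction_mx f M lambda x) d <= 0.

Definition strongly_contracting K f : Prop :=
  exists M (lambda : R), [/\ 0 < lambda, metric_on K M &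
    forall x, K x -> contraction_at f M lambda x].

Definition transverse_contracting K f : Prop :=
  exists M (lambda : R), [/\ 0 < lambda, metric_on K M &
    forall x, K x -> transverse_contraction_at f M lambda x].

End Contraction.

Section Dynamics.
Context {R : realType} {n : nat}.
Implicit Types (f : 'rV[R]_n -> 'rV[R]_n) (K G : set 'rV[R]_n).
Implicit Types (x : R -> 'rV[R]_n).

Definition solution_on f (I : set R) x : Prop :=
  {within I, continuous x} /\
  forall t, I° t -> is_derive t 1 x (f (x t)).

(* Quantifying over solutions on compact intervals covers every solution,
   whatever its interval of existence. *)
Definition strictly_forward_invariant K f : Prop :=
  forall (T : R) x, 0 < T -> solution_on f `[0, T] x -> K (x 0) ->
    forall t, 0 < t <= T -> K° (x t).

Definition smoothly_path_connected K : Prop :=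
  forall p q, K p -> K q -> exists c : R -> 'rV[R]_n,
    [/\ smooth_near (V := R^o) `[0, 1] c, c 0 = p, c 1 = q &
        forall s, 0 <= s <= 1 -> K (c s)].

(* Equilibria are included: [x] may be constant. *)
Definition periodic_orbit f G : Prop :=
  exists x (T : R), [/\ 0 < T, solution_on f setT x,
    forall t, x (t + T) = x t & G = range x].

Definition within_dist G (e : R) (p : 'rV[R]_n) : Prop :=
  exists2 q, G q & `|p - q| < e.

Definition orbitally_stable f G : Prop :=
  forall e : R, 0 < e -> exists2 d : R, 0 < d &
    forall x, solution_on f `[0, +oo[ x -> within_dist G d (x 0) ->
      forall t, 0 <= t -> within_dist G e (x t).

Definition converges_to x G : Prop :=
  forall e : R, 0 < e -> \forall t \near +oo, within_dist G e (x t).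

Definition unique_stable_limit_cycle K f : Prop :=
  exists G, [/\ periodic_orbit f G /\ G `<=` K,
    forall G', periodic_orbit f G' -> G' `<=` K -> G' = G,
    orbitally_stable f G &
    forall x, solution_on f `[0, +oo[ x -> K (x 0) -> converges_to x G].

End Dynamics.

Definition hierarchical {R : realType} {n1 n2 : nat}
    (f1 : 'rV[R]_n1 -> 'rV[R]_n1) (f2 : 'rV[R]_n1 -> 'rV[R]_n2 -> 'rV[R]_n2)
    (x : 'rV[R]_(n1 + n2)) : 'rV[R]_(n1 + n2) :=
  row_mx (f1 (lsubmx x)) (f2 (lsubmx x) (rsubmx x)).

Definition uncurry_row {R : realType} {n1 n2 : nat} {W : Type}
    (g : 'rV[R]_n1 -> 'rV[R]_n2 -> W) (x : 'rV[R]_(n1 + n2)) : W :=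
  g (lsubmx x) (rsubmx x).

(* Main.v *)
Require Import Defs.
From mathcomp Require Import all_boot all_order all_algebra.
From mathcomp Require Import boolp classical_sets functions reals topology
  normedtype derive.
From mathcomp Require Import landau sequences realfun exp interval_inference.
From mathcomp Require Import constructive_ereal measure lebesgue_measure
  lebesgue_integral ftc.
From mathcomp Require Import ring lra.
Set Implicit Arguments.
Unset Strict Implicit.
Unset Printing Implicit Defensive.
Import Order.TTheory GRing.Theory Num.Theory.
Import numFieldNormedType.Exports.
Local Open Scope classical_set_scope.
Local Open Scope ring_scope.

(** The first system contracts, so the squared speed [V = f1' M1 f1] decays
    exponentially along the flow, and the second system is transverse contracting
    up to perturbations that vanish when [f1] does.  A weight [(1 + V)^N] on the
    metric produces a damping proportional to [V], which absorbs these
    perturbations: this is [transverse_contracting_of_blocks], where the constants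
    come one after the other from [compact_finsler].

    That a transverse contracting system has a unique stable limit cycle is
    [transverse_contracting_limit_cycle].  By Finsler's lemma, contraction on the
    hyperplane [d' M f = 0] is contraction in all directions once the penalty
    [rho * (d' M f)^2] is subtracted, and this penalty can be produced by a change
    of speed along an orbit.  Two orbits that start close to each other, one in
    [K], therefore approach each other exponentially fast after a change of time;
    the change of time settles down to a constant shift, an asymptotic phase
    ([asymptotic_phase]).  Existence, uniqueness and stability of the limit cycle
    follow from asymptotic phase by compactness and connectedness of [K]
    ([limit_cycle_of_asymptotic_phase]), by an argument that treats equilibria and
    proper cycles alike.

    Orbits are those of a globally Lipschitz field that agrees with [f] near [K]
    ([lipschitz_extension]); its flow is obtained by Picard iteration ([picard],
    [flow_exists]). *)

(** * Uniformity on compact sets, matrix norms and bilinear forms *)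

Section MatrixNorm.
Context {R : realType}.

Lemma nbhs_distP (V : normedModType R) (x : V) (P : set V) :
  nbhs x P <-> exists2 d : R, 0 < d & forall y, `|x - y| < d -> P y.
Proof.
by split=> [/nbhs_normP[d d0 dP]|[d d0 dP]]; [|apply/nbhs_normP];
  exists d => // y; exact: dP.
Qed.

Lemma continuous_distP (V W : normedModType R) (f : V -> W) (x : V) :
  {for x, continuous f} <-> forall e : R, 0 < e ->
    exists2 d : R, 0 < d & forall y, `|x - y| < d -> `|f x - f y| < e.
Proof.
split=> [/cvgrPdist_lt fx e /fx/nbhs_distP//|fx].
by apply/cvgrPdist_lt => e /fx/nbhs_distP.
Qed.

(** Meant for properties that become weaker as the scale [s] decreases; a bound
    such as a Lipschitz constant enters them as [s^-1]. *)
Lemma compact_uniform_scale (V : normedModType R) (K : set V)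
    (P : R -> V -> Prop) : compact K ->
  (forall x0, K x0 -> exists2 r : R, 0 < r &
     forall x s, `|x0 - x| < r -> 0 < s -> s < r -> P s x) ->
  exists2 s : R, 0 < s & forall x, K x -> P s x.
Proof.
move=> cK KP.
have loc x0 : K x0 -> \forall x \near x0 & s \near (0 : R)^'+, P s x.
  move=> /KP[r r0 rP].
  exists ([set x | `|x0 - x| < r], [set s | 0 < s < r]).
    split; first by apply/nbhs_distP; exists r.
    apply: filterS2 (nbhs_right_gt 0) (nbhs_right_lt r0) => s s0 sr.
    by rewrite /= s0.
  by move=> [x s] /= [x0x /andP[s0 sr]]; exact: rP.
have FF : Filter (0 : R)^'+ by exact: at_right_proper_filter.
have KPs := (compact_near_coveringP _).1 cK _ _ _ FF loc.
near (0 : R)^'+ => s; exists s; first by near: s; exact: nbhs_right_gt.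
by have sP : K `<=` P s by near: s; exact: KPs.
Unshelve. all: by end_near. Qed.

Lemma coord_le_norm m n (A : 'M[R]_(m, n)) i j : `|A i j| <= `|A|.
Proof.
by rewrite [leRHS]/Num.norm /= mx_normrE; exact: (le_bigmax _ _ (i, j)).
Qed.

Lemma norm_le_coord m n (A : 'M[R]_(m, n)) (c : R) :
  0 <= c -> (forall i j, `|A i j| <= c) -> `|A| <= c.
Proof.
move=> c0 Ac; rewrite [leLHS]/Num.norm /= mx_normrE.
by apply: bigmax_le => // -[i j] _; exact: Ac.
Qed.

Lemma is_derive_mxP (V : normedModType R) m n (A : V -> 'M[R]_(m, n)) x v dA :
  is_derive x v A dA <-> forall i j, is_derive x v (fun y => A y i j) (dA i j).
Proof.
split=> [[dAx dAE] i j|dAx].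
  apply: DeriveDef; first exact: (derivable_mxP A x v).1.
  by rewrite -dAE derive_mx// mxE.
have dA' : derivable A x v by apply/derivable_mxP => i j; have [] := dAx i j.
apply: DeriveDef => //; rewrite derive_mx//.
by apply/matrixP => i j; rewrite mxE; have [] := dAx i j.
Qed.

Lemma cvg_mxP (T : Type) (F : set_system T) {FF : Filter F} m n
    (A : T -> 'M[R]_(m, n)) (B : 'M[R]_(m, n)) :
  A x @[x --> F] --> B <-> forall i j, A x i j @[x --> F] --> B i j.
Proof.
split=> [AB i j|AB].
  exact: (cvg_comp _ _ AB (@coord_continuous _ _ _ i j B)).
apply/cvgrPdist_le => /= e e0; near=> x.
apply: norm_le_coord => [|i j]; first exact: ltW.
rewrite !mxE; move: i j; near: x; apply: filter_forall => i.
by apply: filter_forall => j; have /cvgrPdist_le := AB i j; exact.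
Unshelve. all: by end_near. Qed.

End MatrixNorm.

Section BilinearForm.
Context {R : realType}.

(** The number written u' Q v for column vectors.  [qform Q d] is [bil Q d d] by
    conversion. *)
Definition bil m n (Q : 'M[R]_(m, n)) (u : 'rV_m) (v : 'rV_n) : R :=
  (u *m Q *m v^T) 0 0.

Lemma bilE m n (Q : 'M[R]_(m, n)) u v :
  bil Q u v = \sum_i \sum_j u 0 i * Q i j * v 0 j.
Proof.
rewrite /bil mxE exchange_big; apply: eq_bigr => j _.
by rewrite mxE mxE big_distrl.
Qed.

Lemma bilDl m n (Q : 'M[R]_(m, n)) u1 u2 v :
  bil Q (u1 + u2) v = bil Q u1 v + bil Q u2 v.
Proof. by rewrite /bil !mulmxDl mxE. Qed.
Lemma bilDr m n (Q : 'M[R]_(m, n)) u v1 v2 :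
  bil Q u (v1 + v2) = bil Q u v1 + bil Q u v2.
Proof. by rewrite /bil linearD mulmxDr mxE. Qed.
Lemma bilZl m n (Q : 'M[R]_(m, n)) a u v : bil Q (a *: u) v = a * bil Q u v.
Proof. by rewrite /bil -!scalemxAl mxE. Qed.
Lemma bilZr m n (Q : 'M[R]_(m, n)) a u v : bil Q u (a *: v) = a * bil Q u v.
Proof. by rewrite /bil linearZ -!scalemxAr mxE. Qed.
Lemma bilD m n (Q1 Q2 : 'M[R]_(m, n)) u v :
  bil (Q1 + Q2) u v = bil Q1 u v + bil Q2 u v.
Proof. by rewrite /bil mulmxDr mulmxDl mxE. Qed.
Lemma bilZ m n (Q : 'M[R]_(m, n)) a u v : bil (a *: Q) u v = a * bil Q u v.
Proof. by rewrite /bil -scalemxAr -scalemxAl mxE. Qed.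
Lemma bilZZ n (Q : 'M[R]_n) a d : bil Q (a *: d) (a *: d) = a ^+ 2 * bil Q d d.
Proof. by rewrite bilZl bilZr mulrA -expr2. Qed.
Lemma bil0l m n (Q : 'M[R]_(m, n)) v : bil Q 0 v = 0.
Proof. by rewrite /bil !mul0mx mxE. Qed.
Lemma bil0r m n (Q : 'M[R]_(m, n)) u : bil Q u 0 = 0.
Proof. by rewrite /bil trmx0 mulmx0 mxE. Qed.
Lemma bilBl m n (Q : 'M[R]_(m, n)) u1 u2 v :
  bil Q (u1 - u2) v = bil Q u1 v - bil Q u2 v.
Proof. by rewrite bilDl -scaleN1r bilZl mulN1r. Qed.

Lemma bilC n (Q : 'M[R]_n) u v : Q^T = Q -> bil Q u v = bil Q v u.
Proof.
move=> QT; rewrite /bil -[in RHS]QT.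
rewrite [RHS](_ : _ = ((v *m Q^T *m u^T)^T) 0 0); last by rewrite [RHS]mxE.
by rewrite !trmx_mul !trmxK mulmxA.
Qed.

Lemma norm_sum_le n (F : 'I_n -> R) (c : R) :
  (forall i, `|F i| <= c) -> `|\sum_i F i| <= n%:R * c.
Proof.
move=> Fc; apply: le_trans (ler_norm_sum _ _ _) _.
apply: le_trans (ler_sum _ (fun i _ => Fc i)) _.
by rewrite sumr_const card_ord mulr_natl.
Qed.

Lemma bil_bound m n (Q : 'M[R]_(m, n)) u v :
  `|bil Q u v| <= (m * n)%:R * (`|Q| * `|u| * `|v|).
Proof.
rewrite bilE natrM -mulrA; apply: norm_sum_le => i.
apply: norm_sum_le => j; rewrite !normrM [`|Q| * _]mulrC.
by rewrite ler_pM ?mulr_ge0// ?ler_pM// coord_le_norm.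
Qed.

Lemma cvg_bil (T : Type) (F : set_system T) {FF : Filter F} m n
    (Q : T -> 'M[R]_(m, n)) u v Q0 u0 v0 :
  Q x @[x --> F] --> Q0 -> u x @[x --> F] --> u0 -> v x @[x --> F] --> v0 ->
  bil (Q x) (u x) (v x) @[x --> F] --> bil Q0 u0 v0.
Proof.
move=> /cvg_mxP cQ /cvg_mxP cu /cvg_mxP cv; rewrite bilE.
under eq_fun do rewrite bilE.
apply: cvg_big => [|i _]; first exact: add_continuous.
apply: cvg_big => [|j _]; first exact: add_continuous.
by apply: cvgM => //; apply: cvgM.
Qed.

Lemma is_derive_bil (V : normedModType R) m n (Q : V -> 'M[R]_(m, n))
    u v x h dQ du dv :
  is_derive x h Q dQ -> is_derive x h u du -> is_derive x h v dv ->
  is_derive x h (fun y => bil (Q y) (u y) (v y))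
    (bil dQ (u x) (v x) + bil (Q x) du (v x) + bil (Q x) (u x) dv).
Proof.
move=> /is_derive_mxP dQx /is_derive_mxP dux /is_derive_mxP dvx.
rewrite (_ : (fun y => _) =
  \sum_i \sum_j ((fun y => u y 0 i) * (fun y => Q y i j) *
                  (fun y => v y 0 j))); last first.
  rewrite funeqE => y; rewrite bilE fct_sumE; apply: eq_bigr => i _.
  by rewrite fct_sumE.
apply: is_derive_eq.
rewrite !bilE -!big_split/=; apply: eq_bigr => i _.
rewrite -!big_split/=; apply: eq_bigr => j _.
rewrite /GRing.scale/= -[(_ * _) x]/(u x 0 i * Q x i j).
ring.
Qed.

End BilinearForm.

(** * Differential inequalities *)

Section DifferentialInequalities.
Context {R : realType}.

Lemma is_derive_continuous (V : normedModType R) (f : R -> V) (t : R) df :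
  is_derive t 1 f df -> {for t, continuous f}.
Proof.
by move=> [dft _]; apply: differentiable_continuous; apply/derivable1_diffP.
Qed.

Lemma is_derive_chain (V W : normedModType R) (x : R -> V) (f : V -> W)
    (t : R) dx : differentiable f (x t) -> is_derive t 1 x dx ->
  is_derive t 1 (fun s => f (x s)) ('D_dx f (x t)).
Proof.
move=> df [dxt dxE]; have xd : differentiable x t by apply/derivable1_diffP.
have fxd : differentiable (f \o x) t := differentiable_comp xd df.
apply: DeriveDef; first exact: (diff_derivable fxd).
by rewrite -dxE (deriveE _ fxd) (deriveE _ df) (deriveE _ xd) (diff_comp xd df).
Qed.

Lemma is_derive_time_change (W : normedModType R) (x : R -> W) (g : R -> R)
    (t : R) dx dg : is_derive (g t) 1 x dx -> is_derive t 1 g dg ->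
  is_derive t 1 (fun s => x (g s)) (dg *: dx).
Proof.
move=> [dxt dxE] dg'; have xd : differentiable x (g t) by apply/derivable1_diffP.
apply: is_derive_eq (is_derive_chain xd dg') _.
rewrite (deriveE _ xd) -{1}[dg]mulr1 -[dg * 1]/(dg *: (1 : R)) linearZ/=.
by rewrite -(deriveE _ xd) dxE.
Qed.

Lemma is_derive_scale (k t : R) : is_derive t 1 (fun s => k * s) k.
Proof.
by apply: (is_derive_eq (is_deriveZ k (is_derive_id t 1))); rewrite [LHS]mulr1.
Qed.

Lemma is_derive_expR_scale (a t : R) :
  is_derive t 1 (fun s => expR (a * s)) (a * expR (a * t)).
Proof.
rewrite mulrC.
exact: (is_derive1_comp (is_derive_expR (a * t)) (is_derive_scale a t)).
Qed.

(** [e t * expR (- a * t)] is nonincreasing. *)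
Lemma gronwall_scalar (a T : R) (e de : R -> R) :
  {within `[0, T], continuous e} ->
  (forall t : R, 0 < t < T -> is_derive t 1 e (de t)) ->
  (forall t, 0 < t < T -> de t <= a * e t) ->
  forall t, 0 <= t <= T -> e t <= e 0 * expR (a * t).
Proof.
move=> ce dee ae t /andP[t0 tT].
pose g : R -> R := e * (fun s => expR (- a * s)).
have dE (s : R) := is_derive_expR_scale (- a) s.
have dg (s : R) : 0 < s < T ->
    is_derive s 1 g ((de s - a * e s) * expR (- a * s)).
  move=> sT; have := dee _ sT => des; rewrite /g.
  apply: is_derive_eq; rewrite /GRing.scale/=; ring.
have cg : {within `[0, T], continuous g}.
  move=> x; apply: (@continuousM _ (subspace `[0, T])); first exact: ce.
  apply: continuous_subspaceT => y.
  exact: is_derive_continuous (dE y).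
have gt : g t <= g 0.
  apply: (@ler0_derive1_nincr _ g 0 T) => // s; rewrite in_itv/= => sT.
    by have [] := dg _ sT.
  rewrite derive1E; have [_ ->] := dg _ sT.
  by rewrite pmulr_lle0 ?expR_gt0// subr_le0 ae.
move: gt; rewrite /g -[_ 0]/(e 0 * expR (- a * 0)) -[_ t]/(e t * expR (- a * t)).
rewrite mulr0 expR0 mulr1 mulNr expRN.
by rewrite ler_pdivrMr ?expR_gt0.
Qed.

(** The estimate keeps [e] below the threshold [b] under which it is known to
    hold, so it propagates from the initial value. *)
Lemma decay_while_small (c b : R) (e de : R -> R) :
  0 < c -> 0 <= e 0 < b ->
  (forall t : R, 0 <= t -> is_derive t 1 e (de t)) ->
  (forall t, 0 < t -> e t <= b -> de t <= - c * e t) ->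
  forall t, 0 <= t -> e t <= e 0 * expR (- c * t).
Proof.
move=> c0 /andP[e00 e0b] dee small.
have ce (T : R) : {within `[0, T], continuous e}.
  apply: continuous_in_subspaceT => x; rewrite inE/= in_itv/= => /andP[x0 _].
  exact: is_derive_continuous (dee _ x0).
have decays (T : R) : (forall t, 0 < t < T -> e t <= b) ->
    forall t, 0 <= t <= T -> e t <= e 0 * expR (- c * t).
  move=> eb; apply: gronwall_scalar (ce T) _ _ => [t /andP[t0 _]|t].
    exact/dee/ltW.
  by move=> /[dup] /andP[t0 _] /eb; exact: small.
suff le_b t : 0 <= t -> e t <= b.
  move=> t t0; apply: (decays t) => [s /andP[s0 _]|]; first exact/le_b/ltW.
  by rewrite t0 lexx.
move=> t0; rewrite leNgt; apply/negP => bt.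
(* [inf S] is the first time at which the threshold is reached *)
pose S := [set s | 0 <= s /\ b <= e s].
have S0 : S !=set0 by exists t; split => //; exact: ltW.
have lS : lbound S 0 by move=> s [].
have hS : has_inf S by split => //; exists 0.
have i0 : 0 <= inf S by exact: lb_le_inf.
have bi : b <= e (inf S).
  rewrite leNgt; apply/negP => eib.
  have := is_derive_continuous (dee _ i0).
  move=> /cvgrPdist_lt/(_ (b - e (inf S))); rewrite subr_gt0 => /(_ eib).
  move=> [d/= d0 dS].
  have [s [s0 bs] sd] := inf_adherent d0 hS.
  have iS : inf S <= s by apply: ge_inf; [exists 0|].
  have := dS s; rewrite /= ler0_norm ?subr_le0// opprB ltrBlDl => /(_ sd).
  by rewrite ltr_norml => /andP[]; rewrite ltrNl opprB ltrBlDr subrK ltNge bs.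
have := decays (inf S) _ (inf S); rewrite i0 lexx => /(_ _ isT) h.
have : e (inf S) <= e 0 * expR (- c * inf S).
  apply: h => s /andP[s0 si]; rewrite leNgt; apply/negP => bs.
  have : inf S <= s by apply: ge_inf; [exists 0|split; exact: ltW].
  by rewrite leNgt si.
apply/negP; rewrite -ltNge; apply: lt_le_trans bi.
apply: le_lt_trans e0b; rewrite ler_piMr// -expR0 ler_expR mulNr oppr_le0.
by rewrite mulr_ge0// ltW.
Qed.

Lemma ge0_is_derive_le (h dh : R -> R) (a b : R) :
  a <= b -> (forall t : R, a <= t <= b -> is_derive t 1 h (dh t)) ->
  (forall t, a < t < b -> 0 <= dh t) -> h a <= h b.
Proof.
move=> ab hh dh0.
have hoo (t : R) : a < t < b -> is_derive t 1 h (dh t).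
  by move=> /andP[/ltW at' /ltW tb]; apply: hh; rewrite at' tb.
apply: (@ger0_derive1_ndecr _ h a b) => // [t|t|].
- by rewrite in_itv/= => /hoo[].
- by rewrite in_itv/= derive1E => /[dup] /hoo [_ ->]; exact: dh0.
- apply: continuous_in_subspaceT => x; rewrite inE/= in_itv/= => /hh.
  exact: is_derive_continuous.
Qed.

Lemma eq_of_derive_eq (g1 g2 dg : R -> R) (a b : R) :
  a <= b -> (forall t : R, a <= t <= b -> is_derive t 1 g1 (dg t)) ->
  (forall t : R, a <= t <= b -> is_derive t 1 g2 (dg t)) ->
  g1 b - g1 a = g2 b - g2 a.
Proof.
have le (f1 f2 : R -> R) : a <= b ->
    (forall t : R, a <= t <= b -> is_derive t 1 f1 (dg t)) ->
    (forall t : R, a <= t <= b -> is_derive t 1 f2 (dg t)) ->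
    f1 b - f1 a <= f2 b - f2 a.
  move=> ab h1 h2; suff : f2 a - f1 a <= f2 b - f1 b by lra.
  apply: (ge0_is_derive_le (h := f2 - f1) (dh := fun t => dg t - dg t) ab).
    by move=> t tab; apply: is_deriveB; [exact: h2|exact: h1].
  by move=> t _; rewrite subrr.
by move=> ab h1 h2; apply/eqP; rewrite eq_le !le.
Qed.

(** For the sup norm this is the scalar mean value theorem, coordinate by
    coordinate. *)
Lemma mean_value_ineq n (w dw : R -> 'rV[R]_n) (g dg : R -> R) (a b : R) :
  a <= b ->
  (forall t : R, a <= t <= b -> is_derive t 1 w (dw t)) ->
  (forall t : R, a <= t <= b -> is_derive t 1 g (dg t)) ->
  (forall t, a < t < b -> `|dw t| <= dg t) ->
  `|w b - w a| <= g b - g a.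
Proof.
move=> ab ww gg wg.
have g_ab : g a <= g b by apply: ge0_is_derive_le ab gg _ => t /wg; apply: le_trans.
apply: norm_le_coord => [|i j]; first by rewrite subr_ge0.
have wwj t : a <= t <= b -> is_derive t 1 (fun s => w s i j) (dw t i j).
  by move=> /ww/is_derive_mxP; exact.
have wgj t : a < t < b -> `|dw t i j| <= dg t.
  by move=> /wg; apply: le_trans; exact: coord_le_norm.
rewrite !mxE ler_norml; apply/andP; split.
  suff : g a + w a i j <= g b + w b i j by lra.
  apply: (ge0_is_derive_le (h := g + (fun s => w s i j))
    (dh := fun t => dg t + dw t i j) ab) => t tab; last first.
    by have := wgj _ tab; rewrite ler_norml => /andP[+ _]; rewrite lerNl -subr_ge0 opprK.
  by apply: is_deriveD; [exact: gg|exact: wwj].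
suff : g a - w a i j <= g b - w b i j by lra.
apply: (ge0_is_derive_le (h := g - (fun s => w s i j))
    (dh := fun t => dg t - dw t i j) ab) => t tab; last first.
  by have := wgj _ tab; rewrite ler_norml => /andP[_ +]; rewrite -subr_ge0.
by apply: is_deriveB; [exact: gg|exact: wwj].
Qed.

End DifferentialInequalities.

(** * Primitives of continuous functions *)

Section Primitives.
Context {R : realType}.

Lemma primitive_above (g : R -> R) (N : R) : continuous g ->
  exists G : R -> R, forall t : R, - N < t -> is_derive t 1 G (g t).
Proof.
move=> cg; exists (fun x => \int[lebesgue_measure]_(t in `[- N, x]) g t)%R.
move=> t Nt.
have ig : lebesgue_measure.-integrable [set` `[- N, t + 1]] (EFin \o g).
  apply: continuous_compact_integrable; first exact: segment_compact.
  exact: continuous_subspaceT.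
have tt1 : t < t + 1 by rewrite ltrDl.
have [dG GE] := continuous_FTC1_closed tt1 ig Nt (cg t).
by rewrite derive1E in GE; exact: DeriveDef dG GE.
Qed.

(** Primitives on half-lines are glued: two of them, once normalized at 0, agree
    where both are defined. *)
Lemma primitive_exists (g : R -> R) : continuous g ->
  exists G : R -> R, G 0 = 0 /\ forall t : R, is_derive t 1 G (g t).
Proof.
move=> cg; have [H HP] := choice (fun N => primitive_above N cg).
pose G t := H (`|t| + 1) t - H (`|t| + 1) 0.
have HH (N M t : R) : `|t| < N -> `|t| < M -> H N t - H N 0 = H M t - H M 0.
  move=> tN tM; have Nt := lerNnormlW (lexx `|t|).
  have N0 := le_lt_trans (normr_ge0 _) tN.
  have M0 := le_lt_trans (normr_ge0 _) tM.
  have [t0|t0] := leP 0 t.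
    by apply: (eq_of_derive_eq (dg := g) t0) => s /andP[s0 st]; apply: HP;
      rewrite (lt_le_trans _ s0)// oppr_lt0.
  have := eq_of_derive_eq (g1 := H N) (g2 := H M) (dg := g) (ltW t0).
  have tb s K : `|t| < K -> t <= s <= 0 -> - K < s.
    move=> tK /andP[ts s0]; apply: lt_le_trans ts.
    by rewrite ltrNl (le_lt_trans _ tK)// -normrN ler_norm.
  move=> h; suff : H N 0 - H N t = H M 0 - H M t by lra.
  by apply: h => s ts; apply: HP; exact: tb ts.
exists G; split=> [|t]; first by rewrite /G subrr.
have tt2 : - (`|t| + 2) < t.
  rewrite ltrNl (@le_lt_trans _ _ `|t|) ?ltrDl//.
  by rewrite -normrN ler_norm.
have : is_derive t 1 (H (`|t| + 2) - cst (H (`|t| + 2) 0)) (g t).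
  have := HP _ _ tt2 => dH.
  by rewrite -[g t]subr0; apply: is_deriveB.
apply: near_eq_is_derive; near=> s.
rewrite /G -[LHS]/(H (`|t| + 2) s - H (`|t| + 2) 0); apply: HH; last first.
  by rewrite ltrDl.
have st : `|t - s| < 1.
  by near: s; exact: nbhsx_ballx ltr01.
rewrite -[s](subrK t) (le_lt_trans (ler_normD _ _))// addrC ltrD2l distrC.
by apply: lt_trans st _; rewrite ltr1n.
Unshelve. all: by end_near. Qed.

Lemma primitive_rV n (g : R -> 'rV[R]_n) : continuous g ->
  exists G : R -> 'rV[R]_n, G 0 = 0 /\ forall t : R, is_derive t 1 G (g t).
Proof.
move=> cg; have cgi i : continuous (fun t => g t 0 i).
  by move=> t; have /cvg_mxP := cg t; exact.
have [H HP] := choice (fun i => primitive_exists (cgi i)).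
exists (fun t => \row_i H i t); split.
  by apply/rowP => i; rewrite !mxE; have [] := HP i.
move=> t; apply/is_derive_mxP => i j; rewrite (ord1 i).
under eq_fun do rewrite mxE.
by have [_] := HP j.
Qed.

End Primitives.

(** * Picard iteration *)

Section Picard.
Context {R : realType} {n : nat}.
Notation V := ('rV[R]_n).

Lemma is_derive_reflect (w : R -> V) (t : R) dw :
  is_derive (- t) 1 w dw -> is_derive t 1 (fun s => w (- s)) (- dw).
Proof.
move=> dw_t; rewrite -scaleN1r.
exact: is_derive_time_change dw_t (is_deriveNid t 1).
Qed.

(** The weight [expR (2 * L * `|t|)] turns the Picard operator of an
    [L]-Lipschitz field into a contraction of ratio one half. *)
Lemma weighted_growth (L c : R) (w dw : R -> V) : 0 <= c ->
  (forall t : R, is_derive t 1 w (dw t)) ->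
  (forall t, `|dw t| <= 2 * L * c * expR (2 * L * `|t|)) ->
  w 0 = 0 -> forall t, `|w t| <= c * expR (2 * L * `|t|).
Proof.
move=> c0 dwP wL w00 t.
have pos (u du : R -> V) (s : R) : 0 <= s -> (forall t : R, is_derive t 1 u (du t)) ->
    (forall t, `|du t| <= 2 * L * c * expR (2 * L * `|t|)) ->
    u 0 = 0 -> `|u s| <= c * expR (2 * L * `|s|).
  move=> s0 duP uL u0.
  pose g (t : R) := c * expR (2 * L * t).
  have := @mean_value_ineq _ _ u du g
    (fun t => c * (2 * L * expR (2 * L * t))) 0 s s0 (fun t _ => duP t).
  rewrite u0 subr0 /g mulr0 expR0 mulr1 ger0_norm//.
  move=> h; apply: le_trans (h _ _) _.
  - by move=> r _; exact: is_deriveZ (is_derive_expR_scale (2 * L) r).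
  - move=> r /andP[r0 _]; apply: le_trans (uL r) _; rewrite (ger0_norm (ltW r0)).
    by rewrite [leRHS](_ : _ = 2 * L * c * expR (2 * L * r))//; ring.
  - by rewrite gerBl.
have [t0|t0] := leP 0 t; first exact: pos dwP wL w00.
have := @pos (fun s => w (- s)) (fun s => - dw (- s)) (- t).
rewrite opprK normrN; apply; rewrite ?oppr0 ?oppr_ge0 ?ltW//.
- by move=> s; exact: is_derive_reflect.
- by move=> s; rewrite normrN; have := wL (- s); rewrite normrN.
Qed.

Lemma half_powers_small (c e : R) : 0 < e -> exists m : nat, c / 2 ^+ m < e.
Proof.
move=> e0; have d0 : 0 < e / (`|c| + 1) by rewrite divr_gt0// ltr_wpDl.
have [m _ mP] := near_infty_natSinv_expn_lt (PosNum d0).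
exists m; have := mP m (leqnn m); rewrite /= div1r ltr_pdivlMr ?ltr_wpDl//.
apply: le_lt_trans; rewrite mulrC ler_wpM2l ?invr_ge0 ?exprn_ge0//.
by rewrite (le_trans (ler_norm c))// lerDl.
Qed.

(** The weight makes the iterates converge on the whole line at once, so the
    solution is global from the start. *)
Theorem picard (F : R -> V -> V) (L B : R) (p : V) : 0 < L ->
  (forall t x y, `|F t x - F t y| <= L * `|x - y|) ->
  (forall x : R -> V, continuous x -> continuous (fun t => F t (x t))) ->
  (forall t, `|F t p| <= B) ->
  exists x : R -> V, x 0 = p /\ forall t : R, is_derive t 1 x (F t (x t)).
Proof.
move=> L0 FL Fc FB.
have B0 : 0 <= B := le_trans (normr_ge0 _) (FB 0).
have [I IP] : exists I : (R -> V) -> R -> V, forall g, continuous g ->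
    I g 0 = 0 /\ forall t : R, is_derive t 1 (I g) (g t).
  suff /choice : forall g : R -> V, exists G : R -> V, continuous g ->
    G 0 = 0 /\ forall t : R, is_derive t 1 G (g t).
    by move=> [I IP]; exists I.
  move=> g; have [/primitive_rV[G GP]|ng] := pselect (continuous g).
    by exists G.
  by exists (fun=> 0).
pose P (x : R -> V) (t : R) : V := p + I (fun s => F s (x s)) t.
have P0 x : continuous x -> P x 0 = p.
  by move=> /Fc/IP[I0 _]; rewrite /P I0 addr0.
have Pd x : continuous x -> forall t : R, is_derive t 1 (P x) (F t (x t)).
  move=> /Fc/IP[_ dI] t; rewrite -[F t _]add0r.
  exact: is_deriveD (is_derive_cst p t 1) (dI t).
have Pc x : continuous x -> continuous (P x).
  by move=> /Pd dP t; exact: is_derive_continuous (dP t).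
pose xs m := iter m P (cst p).
have xsc m : continuous (xs m).
  by elim: m => [|m]; [move=> t; exact: cvg_cst|exact: Pc].
pose A := B / (2 * L).
have A0 : 0 <= A by rewrite divr_ge0// mulr_ge0// ltW.
pose E (t : R) := expR (2 * L * `|t|).
have E1 t : 1 <= E t by rewrite -expR0 ler_expR !mulr_ge0// ltW.
have P_contr x y c : 0 <= c -> continuous x -> continuous y ->
    (forall t, `|x t - y t| <= c * E t) ->
    forall t, `|P x t - P y t| <= c / 2 * E t.
  move=> c0 cx cy xy; apply: (@weighted_growth _ _ (fun t => P x t - P y t)
      (fun t => F t (x t) - F t (y t))); first by rewrite divr_ge0.
  - by move=> t; apply: is_deriveB; exact: Pd.
  - move=> t; apply: le_trans (FL _ _ _) _.
    rewrite (_ : 2 * L * (c / 2) = L * c); last by field.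
    by rewrite -mulrA ler_wpM2l// ltW.
  - by rewrite !P0// subrr.
have step m t : `|xs m.+1 t - xs m t| <= A / 2 ^+ m * E t.
  elim: m t => [|m ih] t.
    rewrite expr0 divr1; apply: (@weighted_growth _ _ (fun t => P (cst p) t - p)
      (fun t => F t p)) => //.
    - move=> s; rewrite -[F s p]subr0.
      exact: is_deriveB (Pd _ (xsc 0) s) (is_derive_cst p s 1).
    - move=> s; apply: le_trans (FB s) _.
      rewrite (_ : 2 * L * A = B); last by rewrite /A; field; rewrite gt_eqF.
      by rewrite ler_peMr//; exact: E1.
    - by rewrite P0 ?subrr//; exact: (xsc 0).
  rewrite exprSr invfM mulrA; apply: P_contr (xsc _) (xsc _) ih t.
  by rewrite divr_ge0// exprn_ge0.
have tail m k t : `|xs (m + k)%N t - xs m t| <=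
    (A / 2 ^+ m * 2 - A / 2 ^+ (m + k) * 2) * E t.
  elim: k => [|k ih]; first by rewrite addn0 !subrr normr0 mul0r.
  rewrite addnS -(subrKA (xs (m + k)%N t)) (le_trans (ler_normD _ _))//.
  apply: le_trans (lerD (step _ _) ih) _; rewrite -mulrDl ler_wpM2r//.
    exact: le_trans (E1 t).
  rewrite exprS le_eqVlt; apply/orP; left; apply/eqP.
  by field; rewrite ?expf_neq0// pnatr_eq0.
have tail_le m k t : `|xs (m + k)%N t - xs m t| <= A / 2 ^+ m * 2 * E t.
  apply: le_trans (tail m k t) _; rewrite ler_wpM2r//; first exact: le_trans (E1 t).
  by rewrite gerBl mulr_ge0// divr_ge0// exprn_ge0.
have xs_cvg t : cvg (xs m t @[m --> \oo]).
  apply/cauchy_cvgP/cauchy_exP => e e0.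
  have [m mP] := half_powers_small (A * 2 * E t) e0.
  exists (xs m t); exists m => // k /= mk; rewrite -ball_normE /= distrC.
  rewrite -(subnKC mk); apply: le_lt_trans (tail_le m _ t) _.
  by rewrite (_ : _ * E t = A * 2 * E t / 2 ^+ m)//; ring.
pose x t := lim (xs m t @[m --> \oo]).
have x_tail m t : `|x t - xs m t| <= A / 2 ^+ m * 2 * E t.
  apply/ler_addgt0Pl => e e0.
  have /cvgrPdist_lt/(_ _ e0)[N _ NP] := xs_cvg t.
  rewrite -(subrKA (xs (m + N)%N t)) (le_trans (ler_normD _ _))// lerD//.
  by apply/ltW/NP; rewrite /= leq_addl.
have xc : continuous x.
  move=> t; apply/cvgrPdist_lt => e e0.
  pose M := expR (2 * L * (`|t| + 1)).
  have M0 : 0 < M := expR_gt0 _.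
  have [m mP] := half_powers_small (A * 2 * M) (divr_gt0 e0 (ltr0Sn _ 2)).
  have EM s : `|t - s| < 1 -> A / 2 ^+ m * 2 * E s < e / 3.
    move=> ts; apply: le_lt_trans mP.
    rewrite (_ : A * 2 * M / 2 ^+ m = A / 2 ^+ m * 2 * M); last by ring.
    rewrite ler_wpM2l//; first by rewrite mulr_ge0// divr_ge0// exprn_ge0.
    rewrite ler_expR ler_wpM2l//; first by rewrite mulr_ge0// ltW.
    rewrite -[s](subrK t) (le_trans (ler_normD _ _))// addrC lerD2l distrC.
    exact: ltW.
  near=> s.
  have ts : `|t - s| < 1 by near: s; apply/nbhs_ballP; exists 1 => //=.
  rewrite -(subrKA (xs m t)) (le_lt_trans (ler_normD _ _))//.
  rewrite -(subrKA (xs m s) (xs m t)) addrC.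
  apply: le_lt_trans (lerD (ler_normD _ _) (lexx _)) _.
  rewrite (_ : e = e / 3 + e / 3 + e / 3); last by field.
  apply: ltrD; last first.
    by apply: le_lt_trans (x_tail m t) _; apply: EM; rewrite subrr normr0.
  apply: ltrD; last first.
    by rewrite distrC; apply: le_lt_trans (x_tail m s) _; exact: EM.
  by near: s; have /cvgrPdist_lt := xsc m t; apply; rewrite divr_gt0.
exists x; have xP : P x = x.
  apply/funext => t; apply/eqP; rewrite -subr_eq0 -normr_le0.
  apply/ler_addgt0Pl => e e0; rewrite addr0.
  have [m mP] := half_powers_small (A * 2 * E t) e0.
  have PxE : `|P x t - xs m.+1 t| <= A / 2 ^+ m * E t.
    rewrite (_ : A / 2 ^+ m = A / 2 ^+ m * 2 / 2); last by field.
    apply: (P_contr _ _ _ _ xc (xsc m) (x_tail m)).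
    by rewrite mulr_ge0// divr_ge0// exprn_ge0.
  rewrite -(subrKA (xs m.+1 t)) (le_trans (ler_normD _ _))//.
  apply: le_trans (ltW mP).
  rewrite (_ : A * 2 * E t / 2 ^+ m = A / 2 ^+ m * E t + A / 2 ^+ m.+1 * 2 * E t).
    by rewrite lerD// distrC.
  by rewrite exprS; field; rewrite ?expf_neq0// pnatr_eq0.
by split=> [|t]; [rewrite -xP P0|rewrite -{1}xP; exact: Pd].
Unshelve. all: by end_near. Qed.

End Picard.

(** * The flow of a Lipschitz vector field *)

Section Flows.
Context {R : realType} {n : nat}.
Notation V := ('rV[R]_n).

Lemma norm_sqr_le_bil1 (v : V) : `|v| ^+ 2 <= bil 1%:M v v.
Proof.
have bE : bil 1%:M v v = \sum_i v 0 i ^+ 2.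
  by rewrite /bil mulmx1 mxE; apply: eq_bigr => i _; rewrite mxE expr2.
have b0 : 0 <= bil 1%:M v v.
  by rewrite bE sumr_ge0// => i _; rewrite sqr_ge0.
rewrite -(@ler_sqrt _ (`|v| ^+ 2))// sqrtr_sqr normr_id.
apply: norm_le_coord => [|i j]; first exact: sqrtr_ge0.
rewrite -sqrtr_sqr ler_sqrt// bE (ord1 i) (bigD1 j)//= lerDl.
by rewrite sumr_ge0// => k _; rewrite sqr_ge0.
Qed.

(** Gronwall's inequality for the squared Euclidean distance, which is
    differentiable where the norm is not. *)
Lemma ode_dist (F : R -> V -> V) (L : R) : 0 <= L ->
  (forall t x y, `|F t x - F t y| <= L * `|x - y|) ->
  exists C a : R, 0 <= C /\ forall (T : R) (x y : R -> V),
    {within `[0, T], continuous x} -> {within `[0, T], continuous y} ->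
    (forall t : R, 0 < t < T -> is_derive t 1 x (F t (x t))) ->
    (forall t : R, 0 < t < T -> is_derive t 1 y (F t (y t))) ->
    forall t, 0 <= t <= T -> `|x t - y t| <= C * expR (a * t) * `|x 0 - y 0|.
Proof.
move=> L0 FL; pose c := (n * n)%:R * `|1%:M : 'M[R]_n|.
have c0 : 0 <= c by rewrite mulr_ge0.
exists (c + 1), (c * L); split=> [|T x y cx cy dx dy t tT]; first by rewrite addr_ge0.
pose e t := bil 1%:M (x t - y t) (x t - y t).
have cE (u v : V) : `|bil 1%:M u v| <= c * (`|u| * `|v|).
  by rewrite (le_trans (bil_bound _ _ _))// -!mulrA.
pose d t := F t (x t) - F t (y t).
have dw (s : R) : 0 < s < T -> is_derive s 1 (fun s => x s - y s) (d s).
  by move=> sT; have := dx s sT; have := dy s sT => *; apply: is_deriveB.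
have de (s : R) : 0 < s < T -> is_derive s 1 e (2 * bil 1%:M (d s) (x s - y s)).
  move=> sT; have dws := dw s sT.
  apply: is_derive_eq (is_derive_bil (is_derive_cst 1%:M s 1) dws dws) _.
  rewrite (_ : bil 0 _ _ = 0); last by rewrite /bil mulmx0 mul0mx mxE.
  by rewrite add0r [X in _ + X]bilC ?trmx1// mulr2n mulrDl mul1r.
have ce : {within `[0, T], continuous e}.
  by move=> s; apply: cvg_bil; [exact: cvg_cst|apply: cvgB; [exact: cx|exact: cy]..].
have := gronwall_scalar (a := 2 * (c * L)) ce de _ tT.
move=> h; have {h} : e t <= e 0 * expR (2 * (c * L) * t).
  apply: h => s _; rewrite [leRHS](_ : _ = 2 * (c * (L * e s))); last by ring.
  rewrite ler_pM2l//.
  apply: le_trans (ler_norm _) _; apply: le_trans (cE _ _) _.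
  rewrite ler_wpM2l//.
  apply: (@le_trans _ _ (L * `|x s - y s| * `|x s - y s|)).
    by rewrite ler_wpM2r// FL.
  by rewrite -mulrA ler_wpM2l// -expr2 norm_sqr_le_bil1.
move=> et; have X0 : 0 <= expR (c * L * t) := expR_ge0 _.
rewrite -ler_sqr ?nnegrE//; last by rewrite !mulr_ge0// addr_ge0.
apply: le_trans (norm_sqr_le_bil1 _) _; apply: le_trans et _.
rewrite -(mulrA 2) expRM_natl.
rewrite [leRHS](_ : _ = (c + 1) ^+ 2 * `|x 0 - y 0| ^+ 2 *
  expR (c * L * t) ^+ 2); last by ring.
rewrite ler_wpM2r ?exprn_ge0//.
apply: le_trans (ler_norm _) _; apply: le_trans (cE _ _) _.
rewrite -expr2 ler_wpM2r ?exprn_ge0//; nra.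
Qed.

(** The group law and the identification of forward solutions with orbits of the
    flow both express uniqueness; backward times are reflected into forward ones. *)
Lemma flow_exists (F : V -> V) (L B : R) : 0 < L ->
  (forall x y, `|F x - F y| <= L * `|x - y|) -> (forall x, `|F x| <= B) ->
  exists phi : R -> V -> V,
    [/\ forall p, phi 0 p = p,
        forall p (t : R), is_derive t 1 (phi^~ p) (F (phi t p)),
        forall s t p, phi (t + s) p = phi t (phi s p),
        forall t, 0 <= t -> continuous (phi t) &
        forall (T : R) (x : R -> V), {within `[0, T], continuous x} ->
          (forall t : R, 0 < t < T -> is_derive t 1 x (F (x t))) ->
          forall t, 0 <= t <= T -> x t = phi t (x 0)].
Proof.
move=> L0 FL FB.
have Fc : continuous F.
  move=> x; apply/continuous_distP => e e0.
  exists (e / L) => [|y xy]; first by rewrite divr_gt0.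
  by apply: le_lt_trans (FL _ _) _; rewrite mulrC -ltr_pdivlMr.
have ex p : exists x : R -> V, x 0 = p /\ forall t : R, is_derive t 1 x (F (x t)).
  apply: (@picard _ _ (fun=> F) L B p) => // x cx t.
  by apply: continuous_comp; [exact: cx|exact: Fc].
have [phi' phiP] := choice ex; pose phi t p := phi' p t.
have phi0 p : phi 0 p = p by exact: (phiP p).1.
have dphi p (t : R) : is_derive t 1 (phi^~ p) (F (phi t p)).
  exact: (phiP p).2.
have within_phi p T : {within `[0, T], continuous (phi^~ p)}.
  by apply: continuous_subspaceT => t; exact: is_derive_continuous (dphi p t).
have [C [a [C0 dist]]] := ode_dist (ltW L0) (fun=> FL).
have uniq (T : R) (x y : R -> V) : {within `[0, T], continuous x} ->
    {within `[0, T], continuous y} ->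
    (forall t : R, 0 < t < T -> is_derive t 1 x (F (x t))) ->
    (forall t : R, 0 < t < T -> is_derive t 1 y (F (y t))) ->
    x 0 = y 0 -> forall t, 0 <= t <= T -> x t = y t.
  move=> cx cy dx dy xy0 t tT; apply/eqP; rewrite -subr_eq0 -normr_le0.
  by have := dist T x y cx cy dx dy t tT; rewrite xy0 subrr normr0 mulr0.
have uniqR (x y : R -> V) : (forall t : R, is_derive t 1 x (F (x t))) ->
    (forall t : R, is_derive t 1 y (F (y t))) -> x 0 = y 0 -> x = y.
  move=> dx dy xy0; apply/funext => t; have [t0|t0] := leP 0 t.
    apply: (uniq t) => //; last by rewrite t0 lexx.
    - by apply: continuous_subspaceT => s; exact: is_derive_continuous (dx s).
    - by apply: continuous_subspaceT => s; exact: is_derive_continuous (dy s).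
  have dr z (s : R) : (forall t : R, is_derive t 1 z (F (z t))) ->
      is_derive s 1 (fun r => z (- r)) (- F (z (- s))).
    by move=> dz; exact: is_derive_reflect.
  have NFL (s : R) u v : `|- F u - - F v| <= L * `|u - v|.
    by rewrite opprK addrC distrC FL.
  have [C' [a' [C'0 dist']]] := ode_dist (ltW L0) NFL.
  have cr z : (forall t : R, is_derive t 1 z (F (z t))) ->
      {within `[0, - t], continuous (fun r => z (- r))}.
    by move=> dz; apply: continuous_subspaceT => s;
      exact: is_derive_continuous (dr z s dz).
  apply/eqP; rewrite -subr_eq0 -normr_le0 -(opprK t).
  have := dist' (- t) _ _ (cr x dx) (cr y dy) (fun s _ => dr x s dx)
    (fun s _ => dr y s dy) (- t).
  by rewrite oppr0 xy0 subrr normr0 mulr0 oppr_ge0 (ltW t0) lexx; apply.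
exists phi; split => //.
- move=> s t p.
  have := uniqR (fun t => phi (t + s) p) (fun t => phi t (phi s p)).
  move=> h; suff /(congr1 (@^~ t)) :
    (fun t => phi (t + s) p) = (fun t => phi t (phi s p)) by [].
  apply: h => //; last by rewrite add0r phi0.
  move=> {}t; have ds : is_derive t (1 : R) (fun u => u + s) 1 := is_derive_shift t 1 s.
  have h := @is_derive_time_change _ _ (phi^~ p) (fun u => u + s) t _ _
    (dphi p (t + s)) ds.
  by rewrite scale1r in h.
- move=> t t0 p; apply/continuous_distP => e e0.
  have D0 : 0 < C * expR (a * t) + 1 by rewrite ltr_wpDl// mulr_ge0// expR_ge0.
  exists (e / (C * expR (a * t) + 1)) => [|q pq]; first by rewrite divr_gt0.
  have := dist t (phi^~ p) (phi^~ q) (within_phi p t) (within_phi q t)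
    (fun s _ => dphi p s) (fun s _ => dphi q s) t.
  rewrite t0 lexx !phi0 => /(_ isT); move/le_lt_trans; apply.
  apply: (@le_lt_trans _ _ ((C * expR (a * t) + 1) * `|p - q|)).
    by rewrite ler_wpM2r// lerDl.
  by rewrite mulrC -ltr_pdivlMr.
- by move=> T x cx dx; apply: uniq => //; rewrite phi0.
Qed.

End Flows.

(** * Asymptotic phase *)

Section AsymptoticPhase.
Context {R : realType} {n : nat}.
Notation V := ('rV[R]_n).

(** With [E t = a / k * expR (- k * t)], the function [h + E] decreases, [h - E]
    increases, and both have the same limit. *)
Lemma limit_of_decaying_derivative (h dh : R -> R) (a k : R) : 0 < k ->
  (forall t : R, 0 <= t -> is_derive t 1 h (dh t)) ->
  (forall t, 0 <= t -> `|dh t| <= a * expR (- k * t)) ->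
  exists s, forall t, 0 <= t -> `|h t - s| <= a / k * expR (- k * t).
Proof.
move=> k0 dhP dhB.
pose E (t : R) := a / k * expR (- k * t).
have dE (t : R) : is_derive t 1 E (- (a * expR (- k * t))).
  apply: is_derive_eq (is_deriveZ (a / k) (is_derive_expR_scale (- k) t)) _.
  by rewrite /GRing.scale/=; field; rewrite gt_eqF.
have up t t' : 0 <= t -> t <= t' -> h t' + E t' <= h t + E t.
  move=> t0 tt'.
  have := ge0_is_derive_le (h := fun s => - (h s + E s))
     (dh := fun s => - (dh s - a * expR (- k * s))) tt'.
  rewrite lerN2; apply=> s /andP[ts st'].
    have h1 := dhP s (le_trans t0 ts); exact: is_deriveN (is_deriveD h1 (dE s)).
  rewrite oppr_ge0 subr_le0.
  by apply: le_trans (ler_norm _) (dhB _ _); exact: le_trans (ltW ts).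
have dn t t' : 0 <= t -> t <= t' -> h t - E t <= h t' - E t'.
  move=> t0 tt'.
  have := ge0_is_derive_le (h := fun s => h s - E s)
     (dh := fun s => dh s - - (a * expR (- k * s))) tt'.
  apply=> s /andP[ts st'].
    have h1 := dhP s (le_trans t0 ts); exact: is_deriveB h1 (dE s).
  have := dhB s (le_trans t0 (ltW ts)); rewrite ler_norml => /andP[+ _].
  by rewrite opprK -subr_ge0 opprK.
have E0 t : 0 <= t -> 0 <= E t.
  move=> t0; have := le_trans (normr_ge0 _) (dhB t t0).
  rewrite pmulr_lge0 ?expR_gt0// => a0.
  by rewrite mulr_ge0 ?expR_ge0// divr_ge0// ltW.
have cross t t' : 0 <= t -> 0 <= t' -> h t - E t <= h t' + E t'.
  move=> t0 t'0; have [tt'|/ltW t't] := leP t t'.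
    by have := dn _ _ t0 tt'; have := E0 _ t'0; lra.
  by have := up _ _ t'0 t't; have := E0 _ t0; lra.
pose S := [set h t + E t | t in [set t | 0 <= t]].
exists (inf S) => t t0.
have S0 : S !=set0 by exists (h 0 + E 0); exists 0 => //=.
have lS t' : 0 <= t' -> lbound S (h t' - E t').
  by move=> t'0 _ [r r0 <-]; exact: cross.
have h1 : h t - E t <= inf S by apply: lb_le_inf => //; exact: lS.
have h2 : inf S <= h t + E t.
  by apply: ge_inf; [exists (h 0 - E 0); exact: lS|exists t].
by rewrite ler_norml -/(E t); apply/andP; split; lra.
Qed.

(** Let [x] be the orbit of [p] and [z] the orbit of [q] run at the speed [1 + u],
    with [u = - (rho / 2) * delta' M(x) f(x)] and [delta = z - x].  In the derivative
    of the energy [delta' M(x) delta] this feedback contributes to leading order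
    [- rho * (delta' M(x) f(x))^2], exactly what the hypothesis needs to give decay
    in every direction [delta].  The other terms are of higher order, so a small
    [delta] decays exponentially.  Then [u] does too, the accumulated time shift
    converges, and its limit [s] is the asymptotic phase of [q]. *)
Lemma asymptotic_phase (K : set V) (f : V -> V) (phi : R -> V -> V)
    (M : V -> 'M[R]_n) (L B D m Mb lambda rho : R) :
  0 <= L -> (forall x y, `|f x - f y| <= L * `|x - y|) -> (forall x, `|f x| <= B) ->
  (forall p, phi 0 p = p) ->
  (forall p (t : R), is_derive t 1 (phi^~ p) (f (phi t p))) ->
  (forall p t, K p -> 0 <= t -> K (phi t p)) ->
  (forall x, K x -> `|x| <= D) ->
  (forall x, K x -> differentiable M x) ->
  (forall x, K x -> (M x)^T = M x) ->
  0 < m -> (forall x d, K x -> m * `|d| ^+ 2 <= bil (M x) d d) ->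
  (forall x, K x -> `|M x| <= Mb) ->
  (forall eta, 0 < eta -> exists2 r : R, 0 < r & forall x z, K x -> `|z - x| < r ->
     `|f z - f x - 'D_(z - x) f x| <= eta * `|z - x|) ->
  0 < lambda -> 0 <= rho ->
  (forall x d, K x -> 2 * bil (M x) ('D_d f x) d + bil ('D_(f x) M x) d d
     + lambda * bil (M x) d d <= rho * bil (M x) d (f x) ^+ 2) ->
  exists e C k : R, [/\ 0 < e, 0 <= C, 0 < k &
    forall p q, K p -> `|q - p| < e -> exists2 s, `|s| <= C * `|q - p| &
      forall t, 0 <= t ->
        `|phi (t + s) q - phi t p| <= C * `|q - p| * expR (- k * t)].
Proof.
move=> L0 fL fB phi0 dphi Kphi KD Md Msym m0 Mm MMb fdiff lam0 rho0 contr.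
have arith (l rh b1 b2 b3 b4 s a1 a2 a3 a4 : R) :
    2 * b2 + b1 + l * a4 <= rh * s ^+ 2 -> - a1 <= rh * s * b4 ->
    a2 <= l / 4 * a3 -> a1 <= l / 4 * a3 -> l / 2 * a3 <= l / 2 * a4 ->
    2 * b3 <= a2 ->
    b1 + (2 * b2 + 2 * b3 - rh * s ^+ 2 - rh * s * b4) <= - (l / 2) * a4.
  by clear; lra.
have [nK|/existsNP[x0 /contrapT Kx0]] := pselect (forall x, ~ K x).
  by exists 1, 0, 1; split => // p q /nK.
have B0 : 0 <= B := le_trans (normr_ge0 _) (fB 0).
have Mb0 : 0 <= Mb := le_trans (normr_ge0 _) (MMb _ Kx0).
have [c c0 cP] : exists2 c : R, 0 <= c &
    forall x u v, K x -> `|bil (M x) u v| <= c * (`|u| * `|v|).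
  exists ((n * n)%:R * Mb) => [|x u v Kx]; first by rewrite mulr_ge0.
  apply: le_trans (bil_bound _ _ _) _; rewrite -!mulrA ler_wpM2l//.
  by rewrite ler_wpM2r ?mulr_ge0// MMb.
have lip_t q a b : `|phi a q - phi b q| <= B * `|a - b|.
  wlog ab : a b / a <= b => [hw|].
    by have [/hw//|/ltW/hw] := leP a b; rewrite distrC [`|b - a|]distrC.
  rewrite distrC [`|a - b|]distrC [`|b - a|]ger0_norm ?subr_ge0// mulrBr.
  apply: (mean_value_ineq (w := phi^~ q) (dw := fun t => f (phi t q))
    (g := fun t => B * t) (dg := fun=> B) ab).
  - by move=> t _; exact: is_derive_scale.
  - by move=> t _; exact: fB.
(* [eta] and [r] are chosen so that the terms of higher order use up at most
   half of the decay rate *)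
pose Q := rho * c ^+ 2 * B * L.
have Q0 : 0 <= Q by rewrite !mulr_ge0// exprn_ge0.
have c1 : 0 < c + 1 by rewrite ltr_wpDl.
pose eta := lambda * m / (8 * (c + 1)).
have eta0 : 0 < eta by rewrite divr_gt0 ?mulr_gt0.
have etaP : 2 * c * eta <= lambda * m / 4.
  rewrite /eta mulrA ler_pdivrMr ?mulr_gt0//.
  have lm : 0 <= lambda * m by rewrite mulr_ge0// ltW.
  by rewrite (_ : lambda * m / 4 * (8 * (c + 1)) =
    2 * c * (lambda * m) + 2 * (lambda * m)); [lra|field].
have [r0 r00 fr] := fdiff eta eta0.
pose r := Num.min r0 (lambda * m / (4 * (Q + 1))).
have Q1 : 0 < Q + 1 by rewrite ltr_wpDl.
have r_gt0 : 0 < r by rewrite lt_min r00 divr_gt0 ?mulr_gt0.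
have rQ : Q * r <= lambda * m / 4.
  have : r <= lambda * m / (4 * (Q + 1)) by rewrite ge_min lexx orbT.
  rewrite ler_pdivlMr ?mulr_gt0// => h; nra.
pose b := m * r ^+ 2 / 4.
have b0 : 0 < b by rewrite divr_gt0// mulr_gt0// exprn_gt0.
pose e := Num.min 1 (b / (c + 1)).
have e0 : 0 < e by rewrite lt_min ltr01 divr_gt0.
pose C1 := c / m + 1.
have C11 : 1 <= C1 by rewrite lerDr divr_ge0// ltW.
have C10 : 0 <= C1 := le_trans ler01 C11.
pose k := lambda / 4.
have k0 : 0 < k by rewrite divr_gt0.
pose C2 := rho / 2 * c * B * C1.
have C20 : 0 <= C2 by rewrite !mulr_ge0// ?divr_ge0.
have BC2 : 0 <= B * (C2 / k) by rewrite mulr_ge0// divr_ge0// ltW.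
have C2k : 0 <= C2 / k by rewrite divr_ge0// ltW.
exists e, (C1 + B * (C2 / k) + C2 / k), k; split => //.
  exact: addr_ge0 (addr_ge0 C10 BC2) C2k.
move=> p q Kp pq; pose x t := phi t p.
have Kx t : 0 <= t -> K (x t) by exact: Kphi.
have Kabs (t : R) : K (phi `|t| p) by apply: Kphi.
(* absolute values only make the field continuous at negative times *)
pose feedback (t y : R) : R :=
  1 - rho / 2 * bil (M (phi `|t| p)) (phi y q - phi `|t| p) (f (phi `|t| p)).
pose F1 (t : R) (y : 'rV[R]_1) : 'rV[R]_1 := const_mx (feedback t (y 0 0)).
have cabs : continuous (fun t : R => phi `|t| p).
  move=> t; apply: (@continuous_comp _ _ _ (fun t : R => `|t|) (phi^~ p)).
    exact: norm_continuous.
  exact: is_derive_continuous (dphi p _).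
have fc : continuous f.
  move=> y; apply/continuous_distP => d d0.
  have L1 : 0 < L + 1 by rewrite ltr_wpDl.
  exists (d / (L + 1)) => [|y' yy']; first by rewrite divr_gt0.
  apply: le_lt_trans (fL _ _) _; rewrite ltr_pdivlMr// in yy'.
  by apply: le_lt_trans yy'; rewrite mulrC ler_wpM2l// lerDl.
have [tau [tau0 dtau]] : exists tau : R -> R, tau 0 = 0 /\
    forall t : R, is_derive t 1 tau (feedback t (tau t)).
  have [||||tv [tv0 dtv]] := @picard R 1 F1 (rho / 2 * c * B * B + 1)
      (1 + rho / 2 * (c * ((`|q| + D) * B))) 0.
  - by rewrite ltr_wpDl// !mulr_ge0// divr_ge0.
  - move=> t y y'; apply: norm_le_coord => [|i j].
      by rewrite mulr_ge0// addr_ge0// !mulr_ge0// divr_ge0.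
    rewrite !mxE /feedback.
    rewrite (_ : _ - _ = - (rho / 2 *
        bil (M (phi `|t| p)) (phi (y 0 0) q - phi (y' 0 0) q)
        (f (phi `|t| p)))); last by rewrite !bilBl; ring.
    rewrite normrN normrM ger0_norm ?divr_ge0// [leRHS]mulrDl mul1r.
    apply: (@le_trans _ _ (rho / 2 * c * B * B * `|y - y'|)); last by rewrite lerDl.
    rewrite -!mulrA !ler_wpM2l ?invr_ge0//.
    apply: le_trans (cP _ _ _ (Kabs t)) _; rewrite ler_wpM2l//.
    rewrite mulrC ler_pM//; apply: le_trans (lip_t _ _ _) _; rewrite ler_wpM2l//.
    by have := coord_le_norm (y - y') 0 0; rewrite !mxE.
  - move=> y cy t; apply/cvg_mxP => i j; rewrite !mxE.
    under eq_fun do rewrite mxE.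
    apply: cvgB; first exact: cvg_cst.
    apply: cvgM; first exact: cvg_cst.
    apply: cvg_bil.
    + apply: (@continuous_comp _ _ _ (fun t : R => phi `|t| p) M); first exact: cabs.
      by apply: differentiable_continuous; exact: Md.
    + apply: cvgB; last exact: cabs.
      apply: (@continuous_comp _ _ _ (fun t => y t 0 0) (phi^~ q)).
        by have /cvg_mxP := cy t; exact.
      exact: is_derive_continuous (dphi q _).
    + apply: (@continuous_comp _ _ _ (fun t : R => phi `|t| p) f); first exact: cabs.
      exact: fc.
  - move=> t; apply: norm_le_coord => [|i j].
      rewrite addr_ge0// mulr_ge0 ?divr_ge0// mulr_ge0// mulr_ge0//.
      by rewrite addr_ge0// (le_trans (normr_ge0 _) (KD _ Kx0)).
    rewrite !mxE /feedback phi0; apply: le_trans (ler_normB _ _) _; rewrite normr1 lerD2l.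
    rewrite normrM ger0_norm ?divr_ge0// ler_wpM2l ?divr_ge0//.
    apply: le_trans (cP _ _ _ (Kabs t)) _; rewrite ler_wpM2l// ler_pM//.
    by apply: le_trans (ler_normB _ _) _; rewrite lerD2l KD.
  exists (fun t => tv t 0 0); split=> [|t]; first by rewrite tv0 mxE.
  by have /is_derive_mxP/(_ 0 0) := dtv t; rewrite mxE.
pose z t := phi (tau t) q; pose dl t := z t - x t.
pose u t := - (rho / 2) * bil (M (x t)) (dl t) (f (x t)).
have uE t : 0 <= t -> feedback t (tau t) = 1 + u t.
  by move=> t0; rewrite /feedback ger0_norm// -/(x t) -/(z t) -/(dl t) /u mulNr.
pose ddl t := (1 + u t) *: f (z t) - f (x t).
have dldP (t : R) : 0 <= t -> is_derive t 1 dl (ddl t).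
  move=> t0; have dz := @is_derive_time_change _ _ (phi^~ q) tau t _ _
    (dphi q (tau t)) (dtau t).
  by rewrite uE// in dz; exact: is_deriveB dz (dphi p t).
pose E t := bil (M (x t)) (dl t) (dl t).
pose dE t := bil ('D_(f (x t)) M (x t)) (dl t) (dl t) + 2 * bil (M (x t)) (dl t) (ddl t).
have dEP (t : R) : 0 <= t -> is_derive t 1 E (dE t).
  move=> t0; have h := dldP t t0.
  have hM := @is_derive_chain _ _ _ (phi^~ p) M t _ (Md _ (Kx t t0)) (dphi p t).
  apply: is_derive_eq (is_derive_bil hM h h) _.
  by rewrite [bil _ (ddl t) _]bilC ?Msym// ?/dE; [ring|exact: Kx].
have E_ge t : 0 <= t -> m * `|dl t| ^+ 2 <= E t by move=> t0; exact: Mm (Kx t t0).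
have small t : 0 < t -> E t <= b -> dE t <= - (lambda / 2) * E t.
  move=> /ltW t0 Eb; have Kxt := Kx t t0.
  have Em := E_ge t t0.
  set N := `|dl t| in Em *; have N0 : 0 <= N := normr_ge0 _.
  have Nr : N <= r / 2.
    have r20 : 0 <= r / 2 by rewrite divr_ge0// ltW.
    rewrite -(ler_pXn2r (n := 2))// ?nnegrE// -(ler_pM2l m0).
    apply: le_trans Em _; apply: le_trans Eb _.
    by rewrite le_eqVlt /b; apply/orP; left; apply/eqP; field.
  have Nr0 : N < r0.
    apply: le_lt_trans Nr _; apply: (@lt_le_trans _ _ r); last by rewrite ge_min lexx.
    by rewrite ltr_pdivrMr// mulrDr mulr1 ltrDl.
  pose w := f (z t) - f (x t) - 'D_(dl t) f (x t).
  have wN : `|w| <= eta * N by exact: fr Kxt Nr0.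
  have fN : `|f (z t) - f (x t)| <= L * N by exact: fL.
  set s := bil (M (x t)) (dl t) (f (x t)).
  have ddlE : ddl t = 'D_(dl t) f (x t) + w + u t *: f (x t) + u t *: (f (z t) - f (x t)).
    by apply/rowP => i; rewrite !mxE; ring.
  have := contr _ (dl t) Kxt; rewrite bilC ?Msym// -/s -/(E t) => ct.
  have h1 : `|bil (M (x t)) (dl t) w| <= c * (N * (eta * N)).
    by apply: le_trans (cP _ _ _ Kxt) _; rewrite ler_wpM2l// ler_wpM2l.
  have h2 : `|bil (M (x t)) (dl t) (f (z t) - f (x t))| <= c * (N * (L * N)).
    by apply: le_trans (cP _ _ _ Kxt) _; rewrite ler_wpM2l// ler_wpM2l.
  have h3 : `|s| <= c * (N * B).
    by apply: le_trans (cP _ _ _ Kxt) _; rewrite ler_wpM2l// ler_wpM2l.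
  have h4 : `|rho * s * bil (M (x t)) (dl t) (f (z t) - f (x t))| <= Q * r * N ^+ 2.
    rewrite !normrM (ger0_norm rho0).
    apply: (@le_trans _ _ (rho * (c * (N * B)) * (c * (N * (L * N))))).
      by rewrite ler_pM// ?mulr_ge0// ler_wpM2l.
    rewrite (_ : _ * _ = Q * N * N ^+ 2); last by rewrite /Q; ring.
    rewrite ler_wpM2r ?exprn_ge0// ler_wpM2l// (le_trans Nr)//.
    by rewrite ler_pdivrMr// mulrDr mulr1 lerDl ltW.
  rewrite /dE ddlE (bilDr _ _ (_ + _ + _)) (bilDr _ _ (_ + _)).
  rewrite (bilDr _ _ ('D__ _ _)) !bilZr /u -/s.
  move: h1 h4; rewrite !ler_norml => /andP[_ h1] /andP[h4 _].
  have N2 : 0 <= N ^+ 2 by rewrite exprn_ge0.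
  have h5 : 2 * c * eta * N ^+ 2 <= lambda / 4 * (m * N ^+ 2)
    by rewrite [leRHS]mulrA [lambda / 4 * m]mulrAC; rewrite ler_wpM2r.
  have h6 : Q * r * N ^+ 2 <= lambda / 4 * (m * N ^+ 2)
    by rewrite [leRHS]mulrA [lambda / 4 * m]mulrAC; rewrite ler_wpM2r.
  have h7 : lambda / 2 * (m * N ^+ 2) <= lambda / 2 * E t.
    by rewrite ler_wpM2l// divr_ge0// ltW.
  move: ct h1 h4 h5 h6 h7.
  set b1 := bil ('D__ M _) _ _; set b2 := bil _ (dl t) ('D__ f _).
  set b3 := bil _ _ w; set b4 := bil _ _ (f (z t) - _).
  move=> ct h1 h4 h5 h6 h7.
  have -> : 2 * (b2 + b3 + - (rho / 2) * s * s + - (rho / 2) * s * b4) =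
    2 * b2 + 2 * b3 - rho * s ^+ 2 - rho * s * b4 by field.
  have {}h1 : 2 * b3 <= 2 * c * eta * N ^+ 2.
    apply: (@le_trans _ _ (2 * (c * (N * (eta * N))))); first by rewrite ler_wpM2l.
    by rewrite le_eqVlt; apply/orP; left; apply/eqP; ring.
  move: ct h4 h5 h6 h7 h1.
  exact: arith.
have N0E : 0 <= `|q - p| by [].
have dl0 : dl 0 = q - p by rewrite /dl /z tau0 /x !phi0.
have E0le : E 0 <= c * `|q - p| ^+ 2.
  rewrite /E dl0 expr2; apply: le_trans (ler_norm _) (cP _ _ _ (Kx 0 (lexx 0))).
have E0b : 0 <= E 0 < b.
  apply/andP; split.
    by apply: le_trans (E_ge 0 (lexx 0)); rewrite mulr_ge0 ?exprn_ge0// ltW.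
  move: pq; rewrite lt_min ltr_pdivlMr// => /andP[pq1 pqb].
  apply: le_lt_trans E0le _; apply: le_lt_trans pqb.
  rewrite expr2 mulrCA ler_wpM2l// (@le_trans _ _ c) ?lerDl// ler_piMr//.
  exact: ltW.
have l20 : 0 < lambda / 2 by rewrite divr_gt0.
have decay := decay_while_small l20 E0b dEP small.
have dlN t : 0 <= t -> `|dl t| <= C1 * `|q - p| * expR (- k * t).
  move=> t0; set X := expR _; have X0 : 0 <= X := expR_ge0 _.
  have EX : E t <= c * `|q - p| ^+ 2 * X ^+ 2.
    apply: le_trans (decay t t0) _.
    rewrite (_ : expR (- (lambda / 2) * t) = X ^+ 2).
      by rewrite ler_wpM2r ?exprn_ge0.
    by rewrite -expRM_natl; congr expR; rewrite /k; field.
  rewrite -(ler_pXn2r (n := 2))// ?nnegrE ?mulr_ge0//.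
  rewrite -(ler_pM2l m0); apply: le_trans (E_ge t t0) _; apply: le_trans EX _.
  rewrite 2!exprMn 2!(mulrA m) ler_wpM2r ?exprn_ge0// ler_wpM2r ?exprn_ge0//.
  have -> : c = m * (C1 - 1) by rewrite /C1; field; rewrite gt_eqF.
  by rewrite ler_pM2l// (@le_trans _ _ C1) ?gerBl// expr2 ler_peMr.
have uN t : 0 <= t -> `|u t| <= C2 * `|q - p| * expR (- k * t).
  move=> t0; rewrite /u normrM normrN (ger0_norm (divr_ge0 rho0 (ler0n _ 2))).
  rewrite [leRHS](_ : _ = rho / 2 * (c * (C1 * `|q - p| * expR (- k * t) * B)));
    last by rewrite /C2; ring.
  rewrite ler_wpM2l ?divr_ge0//; apply: le_trans (cP _ _ _ (Kx t t0)) _.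
  by rewrite ler_wpM2l// ler_pM// dlN.
have [s sP] : exists s, forall t, 0 <= t ->
    `|tau t - t - s| <= C2 * `|q - p| / k * expR (- k * t).
  apply: (@limit_of_decaying_derivative (fun t => tau t - t) u) => //.
  move=> t t0; have := dtau t; rewrite uE// => h.
  by apply: is_derive_eq (is_deriveB h (is_derive_id t 1)) _; rewrite addrC addKr.
exists s.
  have := sP 0 (lexx 0); rewrite tau0 subrr sub0r normrN mulr0 expR0 mulr1.
  move/le_trans; apply; rewrite mulrAC ler_wpM2r//.
  by rewrite lerDr; exact: addr_ge0 C10 BC2.
move=> t t0; have X0 : 0 <= expR (- k * t) := expR_ge0 _.
have -> : phi (t + s) q - phi t p = (phi (t + s) q - z t) + dl t by rewrite /dl /x subrKA.
apply: le_trans (ler_normD _ _) _.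
have h1 : `|phi (t + s) q - z t| <= B * (C2 * `|q - p| / k * expR (- k * t)).
  apply: le_trans (lip_t _ _ _) _; rewrite ler_wpM2l//.
  by apply: le_trans (sP t t0); rewrite distrC opprD addrA.
apply: le_trans (lerD h1 (dlN t t0)) _.
rewrite -subr_ge0.
rewrite (_ : _ - _ = C2 / k * `|q - p| * expR (- k * t)); last by ring.
exact: mulr_ge0 (mulr_ge0 C2k N0E) X0.
Qed.

End AsymptoticPhase.

(** * Limit cycles from asymptotic phase *)

Section LimitCycle.
Context {R : realType} {n : nat}.
Notation V := ('rV[R]_n).

Lemma compact_cluster_point (K : set V) (u : nat -> V) :
  compact K -> (forall i, K (u i)) ->
  exists2 z, K z & forall e : R, 0 < e -> forall N : nat,
    exists2 i, (N <= i)%N & `|u i - z| < e.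
Proof.
move=> cK Ku.
have [|z [Kz cz]] := cK (u i @[i --> \oo]) _; first by exists 0%N => // i _; exact: Ku.
exists z => // e e0 N.
have UN : (u i @[i --> \oo]) (u @` [set i | (N <= i)%N]).
  by exists N => // i /= Ni; exists i.
have Bz : nbhs z [set y | `|y - z| < e].
  by apply/nbhs_distP; exists e => // y; rewrite distrC.
by have [_ [[i Ni <-] iz]] := cz _ _ UN Bz; exists i.
Qed.

Lemma expR_decay_small (c k e : R) : 0 < k -> 0 < e ->
  exists2 T : R, 0 <= T & forall t, T <= t -> c * expR (- k * t) < e.
Proof.
move=> k0 e0; exists (`|c| / (k * e)) => [|t].
  by rewrite divr_ge0// mulr_ge0// ltW.
rewrite ler_pdivrMr ?mulr_gt0// => ct.
rewrite mulNr expRN ltr_pdivrMr ?expR_gt0//.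
apply: (@lt_le_trans _ _ (e * (1 + k * t))); last by rewrite ler_pM2l// expR_ge1Dx.
apply: le_lt_trans (ler_norm c) _; apply: le_lt_trans ct _.
by rewrite mulrDr mulr1 [t * _](_ : _ = e * (k * t)); [rewrite ltrDr|ring].
Qed.

Lemma path_connected_connected (K : set V) :
  smoothly_path_connected K -> connected K.
Proof.
move=> pc; have [->|/set0P[z Kz]] := eqVneq K set0; first exact: connected0.
have /choice[c cP] : forall q, exists c : R -> V, K q ->
    [/\ {within `[0, 1], continuous c}, c 0 = z, c 1 = q &
        forall s, 0 <= s <= 1 -> K (c s)].
  move=> q; have [Kq|nKq] := pselect (K q); last by exists (fun=> 0).
  have [c [[U [_ sU cU]] c0 c1 cK]] := pc _ _ Kz Kq.
  exists c => _; split => //; apply: continuous_in_subspaceT => s.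
  by rewrite inE => /sU; exact: (cU 0%N).
have -> : K = \bigcup_(q in K) (c q @` `[0, 1]).
  apply/seteqP; split=> [q Kq|_ [q Kq] [s s01 <-]].
    by exists q => //; exists 1; [rewrite /= in_itv/= ler01 lexx|have [] := cP q Kq].
  by have [_ _ _] := cP q Kq; apply; move: s01; rewrite /= in_itv.
apply: bigcup_connected.
  exists z => q Kq; exists 0; [by rewrite /= in_itv/= ler01 lexx|by have [] := cP q Kq].
move=> q Kq; apply: connected_continuous_connected; last by have [] := cP q Kq.
exact: segment_connected.
Qed.

(** Some orbit nearly returns, after a time [T1], to a point [p] that it has
    visited.  Asymptotic phase corrects [T1] to a [T] for which the time-[T] map
    moves the points of that orbit by amounts tending to zero, so it fixes their
    limit points: this gives a periodic orbit [G].  Points that are close to each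
    other have the same asymptotic behaviour, hence the points attracted by [G]
    form an open and closed part of the connected set [K].  A periodic orbit
    attracted by [G] is [G], and stability is the estimate of asymptotic phase. *)
Lemma limit_cycle_of_asymptotic_phase (K : set V) (f : V -> V)
    (phi : R -> V -> V) (e C k : R) :
  K !=set0 -> compact K -> connected K ->
  (forall p, phi 0 p = p) ->
  (forall s t p, phi (t + s) p = phi t (phi s p)) ->
  (forall t, 0 <= t -> continuous (phi t)) ->
  (forall p, continuous (phi^~ p)) ->
  (forall p t, K p -> 0 < t -> K° (phi t p)) ->
  (forall x, solution_on f `[0, +oo[ x -> K (x 0) ->
     forall t, 0 <= t -> x t = phi t (x 0)) ->
  (forall p, (forall t, K (phi t p)) -> solution_on f setT (phi^~ p)) ->
  0 < e -> 0 <= C -> 0 < k ->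
  (forall p q, K p -> `|q - p| < e -> exists2 s, `|s| <= C * `|q - p| &
     forall t, 0 <= t ->
       `|phi (t + s) q - phi t p| <= C * `|q - p| * expR (- k * t)) ->
  unique_stable_limit_cycle K f.
Proof.
move=> [p0 Kp0] cK connK phi0 phiD phic phict phiK solE solT e0 C0 k0 AP.
have Kfwd p t : K p -> 0 <= t -> K (phi t p).
  move=> Kp; rewrite le_eqVlt => /predU1P[<-|t0]; first by rewrite phi0.
  by apply: interior_subset; exact: phiK.
have expk1 t : 0 <= t -> expR (- k * t) <= 1.
  by move=> t0; rewrite -expR0 ler_expR mulNr oppr_le0 mulr_ge0// ltW.
have [z [T [T0 Kz zT]]] : exists z T, [/\ 0 < T, K z & phi T z = z].
  have [c Kc cP] := compact_cluster_point cK (fun i => Kfwd p0 i%:R Kp0 (ler0n _ i)).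
  pose d := Num.min e (2 * (C + 1))^-1.
  have C1 : 0 < C + 1 by rewrite ltr_wpDl.
  have d0 : 0 < d by rewrite lt_min e0 invr_gt0 mulr_gt0.
  have d20 : 0 < d / 2 by rewrite divr_gt0.
  have [i _ iP] := cP _ d20 0%N.
  have [j ij jP] := cP _ d20 i.+1.
  pose p := phi i%:R p0; pose q := phi j%:R p0; pose T1 : R := j%:R - i%:R.
  have Kp : K p by exact: Kfwd.
  have T11 : 1 <= T1 by rewrite lerBrDr nat1r ler_nat.
  have qE : q = phi T1 p by rewrite /p -phiD subrK.
  have qp : `|q - p| < d.
    rewrite -(subrKA c) (le_lt_trans (ler_normD _ _))// (splitr d) ltrD//.
    by rewrite distrC.
  have [qpe qpC] : `|q - p| < e /\ `|q - p| < (2 * (C + 1))^-1.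
    by move: qp; rewrite lt_min => /andP.
  have [s sC sP] := AP p q Kp qpe.
  have s12 : `|s| <= 1 / 2.
    apply: le_trans sC _; move: qpC; rewrite -[_^-1]mul1r ltr_pdivlMr ?mulr_gt0// => qpC.
    by rewrite ler_pdivlMr//; have := normr_ge0 (q - p); nra.
  pose T := T1 + s.
  have T0 : 0 < T by move: s12; rewrite ler_norml /T => /andP[]; lra.
  have sT t : phi (t + s) q = phi (t + T) p by rewrite qE -phiD /T; congr phi; ring.
  have [z Kz zP] := compact_cluster_point cK
    (fun i => Kfwd p (i%:R * T) Kp (mulr_ge0 (ler0n _ i) (ltW T0))).
  exists z, T; split => //; apply/eqP; rewrite -subr_eq0 -normr_le0.
  apply/ler_addgt0Pl => h h0; rewrite addr0.
  have h30 : 0 < h / 3 by rewrite divr_gt0.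
  have /continuous_distP/(_ _ h30)[r r0 rP] := phic T (ltW T0) z.
  have [T2 T20 T2P] := expR_decay_small (C * `|q - p|) k0 h30.
  pose N := (Num.truncn (T2 / T)).+1.
  have [l Nl lP] : exists2 l, (N <= l)%N & `|phi (l%:R * T) p - z| < Num.min r (h / 3).
    by apply: zP; rewrite lt_min r0.
  have lT : T2 <= l%:R * T.
    rewrite -ler_pdivrMr//; apply/ltW; apply: lt_le_trans (truncnS_gt _) _.
    by rewrite ler_nat.
  move: lP; rewrite lt_min => /andP[lr lh].
  set pl := phi (l%:R * T) p in lr lh.
  have step : `|phi T pl - pl| < h / 3.
    rewrite -phiD [T + _]addrC -sT; apply: le_lt_trans (T2P _ lT).
    by apply: sP; rewrite mulr_ge0// ltW.
  have -> : phi T z - z = (phi T z - phi T pl) + (phi T pl - pl) + (pl - z).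
    by rewrite !subrKA.
  rewrite (_ : h = h / 3 + h / 3 + h / 3); last by field.
  apply: le_trans (ler_normD _ _) _; apply: lerD (ltW lh).
  apply: le_trans (ler_normD _ _) _; apply: lerD (ltW step).
  by apply/ltW/rP; rewrite distrC.
have zTj t (j : nat) : phi (t + j%:R * T) z = phi t z.
  elim: j t => [|j ih] t; first by rewrite mul0r addr0.
  by rewrite -natr1 mulrDl mul1r addrA phiD zT ih.
have later t : exists j : nat, 0 < t + j%:R * T.
  exists (Num.truncn (- t / T)).+1.
  by rewrite -ltrBlDl sub0r -ltr_pdivrMr// truncnS_gt.
have Kiz t : K° (phi t z).
  by have [j jP] := later t; rewrite -(zTj t j); exact: phiK.
pose G := range (phi^~ z).
have GK : G `<=` K by move=> _ [t _ <-]; exact: interior_subset.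
have Gz t : G (phi t z) by exists t.
have cG : compact G.
  have -> : G = (phi^~ z) @` `[0, T].
    apply/seteqP; split=> [_ [t _ <-]|_ [t _ <-]]; last exact: Gz.
    have [j /ltW jP] := later t; rewrite -(zTj t j); set u := t + _ in jP *.
    have uT : 0 <= u / T by rewrite divr_ge0// ltW.
    have /andP[] := truncn_itv uT; set i := Num.truncn _ => iu ui.
    exists (u - i%:R * T); last by rewrite -(zTj _ i) subrK.
    rewrite /= in_itv/= subr_ge0 -ler_pdivlMr// iu/= lerBlDr.
    by apply/ltW; move: ui; rewrite ltr_pdivrMr// -natr1 mulrDl mul1r addrC.
  apply: continuous_compact; last exact: segment_compact.
  exact: continuous_subspaceT.
have clG : closed G by apply: compact_closed => //; exact: norm_hausdorff.
pose A q := forall h : R, 0 < h -> exists2 T1 : R, 0 <= T1 &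
  forall t, T1 <= t -> within_dist G h (phi t q).
have wd_le h1 (a b : V) : within_dist G h1 a -> forall h2, `|b - a| < h2 ->
    within_dist G (h1 + h2) b.
  move=> [g Gg ag] h2 ba; exists g => //.
  by rewrite -(subrKA a) (le_lt_trans (ler_normD _ _))// addrC ltrD.
have late (a b c s t : R) : 0 <= a -> 0 <= b -> s <= c -> a + b + c <= t ->
    a <= t - s /\ b <= t - s.
  by clear; move=> *; split; lra.
have A_near p q : K p -> `|q - p| < e -> A p <-> A q.
  move=> Kp pq; have [s sC sP] := AP p q Kp pq.
  split=> Apq h h0; have h20 : 0 < h / 2 by rewrite divr_gt0.
    have [T1 T10 T1P] := Apq _ h20.
    have [T2 T20 T2P] := expR_decay_small (C * `|q - p|) k0 h20.
    exists (T1 + T2 + `|s|) => [|t tT]; first by rewrite !addr_ge0.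
    have [t1 t2] := late _ _ _ _ _ T10 T20 (ler_norm s) tT.
    rewrite -(subrK s t) (splitr h); apply: wd_le; first exact: T1P t1.
    exact: le_lt_trans (sP _ (le_trans T20 t2)) (T2P _ t2).
  have [T1 T10 T1P] := Apq _ h20.
  have [T2 T20 T2P] := expR_decay_small (C * `|q - p|) k0 h20.
  exists (T1 + T2 + `|s|) => [|t tT]; first by rewrite !addr_ge0.
  have sle : - s <= `|s| by rewrite -normrN ler_norm.
  have [] := late _ _ _ _ _ T10 T20 sle tT; rewrite opprK => t1 _.
  have [_ t2] := late _ _ _ _ _ T10 T20 (normr_ge0 s) tT; rewrite subr0 in t2.
  rewrite (splitr h); apply: wd_le; first exact: T1P t1.
  by rewrite distrC; exact: le_lt_trans (sP _ (le_trans T20 t2)) (T2P _ t2).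
have AK q : K q -> A q.
  have ballo (P : set V) : open [set v | exists2 q, P q & `|v - q| < e].
    rewrite openE => v /= [p Pp vp]; apply/nbhs_distP.
    exists (e - `|v - p|) => [|y vy]; first by rewrite subr_gt0.
    exists p => //; rewrite -(subrKA v) (le_lt_trans (ler_normD _ _))//.
    by rewrite -ltrBrDr distrC.
  suff -> : K = K `&` A by case.
  apply/esym/connK.
  - exists z; split => // h h0; exists 0 => // t _.
    by exists (phi t z); rewrite ?subrr ?normr0.
  - exists [set v | exists2 q, (K `&` A) q & `|v - q| < e]; first exact: ballo.
    apply/seteqP; split=> v [Kv Av]; split => //.
      by exists v => //; rewrite subrr normr0.
    by case: Av => p [Kp Ap] vp; exact: (A_near p v Kp vp).1.
  - exists (~` [set v | exists2 q, (K `&` (~` A)) q & `|v - q| < e]).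
      by apply: open_closedC; exact: ballo.
    apply/seteqP; split=> v [Kv Av]; split => //.
      by case=> p [Kp nAp] vp; apply: nAp; apply/(A_near p v).
    by apply: contrapT => nAv; apply: Av; exists v; rewrite ?subrr ?normr0.
exists G; split.
- split => //; exists (phi^~ z), T; split => //.
    by apply: solT => t; exact: interior_subset.
  by move=> t; have := zTj t 1%N; rewrite mul1r.
- move=> G' [x [T1 [T10 xsol xT ->]]] G'K.
  have Kx t : K (x t) by apply: G'K; exists t.
  have xE t : 0 <= t -> x t = phi t (x 0).
    move=> t0; apply: solE => //; split.
      by have [cx _] := xsol; apply: continuous_subspaceW cx.
    by move=> s _; have [_] := xsol; apply; rewrite interiorT.
  have xTj t (j : nat) : x (t + j%:R * T1) = x t.
    elim: j t => [|j ih] t; first by rewrite mul0r addr0.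
    by rewrite -natr1 mulrDl mul1r addrA xT ih.
  have Gx t : G (x t).
    suff : closure G (x t) by rewrite -((closure_id _).1 clG).
    move=> B /nbhs_distP[r r0 rB].
    have [T2 T20 T2P] := AK _ (Kx 0) _ r0.
    pose j := (Num.truncn ((T2 - t) / T1)).+1.
    have jP : T2 <= t + j%:R * T1.
      by rewrite -lerBlDl -ler_pdivrMr//; apply/ltW/truncnS_gt.
    have [g Gg] := T2P _ jP; rewrite -xE ?(le_trans T20)// xTj => xg.
    by exists g; split => //; exact: rB.
  apply/seteqP; split=> [_ [t _ <-]//|_ [t _ <-]].
  have [a _ aE] := Gx 0.
  have [j /ltW jP] := later (t - a).
  exists (t - a + j%:R * T) => //.
  by rewrite xE// -aE -phiD -(zTj t j); congr phi; ring.
- move=> h h0.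
  have [r r0 rP] : exists2 r : R, 0 < r & forall g v, G g -> `|v - g| < r -> K v.
    have [|r r0 rP] := compact_uniform_scale cG
        (P := fun r g => forall v, `|v - g| < r -> K v); last first.
      by exists r => // g v /rP; exact.
    move=> _ [t _ <-]; have /nbhs_distP[r r0 rK] := Kiz t.
    exists (r / 2) => [|g s gr s0 sr v vg]; first by rewrite divr_gt0.
    apply: rK; rewrite -(subrKA g) (le_lt_trans (ler_normD _ _))// (splitr r).
    by rewrite ltrD// distrC (lt_trans vg).
  have C1 : 0 < C + 1 by rewrite ltr_wpDl.
  pose d := Num.min e (Num.min r (h / (C + 1))).
  exists d; first by rewrite !lt_min e0 r0 divr_gt0.
  move=> x xsol [g Gg]; rewrite !lt_min => /and3P[xe xr xh] t t0.
  have Kx : K (x 0) by exact: rP xr.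
  have gx : `|g - x 0| < e by rewrite distrC.
  have [s _ sP] := AP _ _ Kx gx.
  exists (phi (t + s) g).
    by case: Gg => a _ <-; rewrite -phiD; exact: Gz.
  rewrite solE// distrC; apply: le_lt_trans (sP t t0) _.
  move: xh; rewrite ltr_pdivlMr// distrC => xh.
  apply: le_lt_trans xh; rewrite -mulrA mulrCA ler_wpM2l//.
  apply: (@le_trans _ _ C); last by rewrite lerDl.
  by rewrite ler_piMr// expk1.
- move=> x xsol Kx h h0; have [T1 T10 T1P] := AK _ Kx _ h0.
  exists T1; split; first exact: num_real.
  move=> t /ltW T1t; rewrite solE//; first exact: T1P.
  exact: le_trans T1t.
Qed.

End LimitCycle.

(** * Finsler's lemma on compact sets; continuously differentiable maps *)

Section Compactness.
Context {R : realType}.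

(** A form of Finsler's lemma.  By homogeneity [d] may be taken of norm 1; on the
    compact set of such pairs [(x, d)], either [h] is bounded below or [(x, d)] is
    close to a zero of [h], where [g] is negative. *)
Lemma compact_finsler (V : normedModType R) m (K : set V)
    (g h : V -> 'rV[R]_m -> R) : compact K ->
  (forall x d, K x -> {for (x, d), continuous (fun y => g y.1 y.2)}) ->
  (forall x d, K x -> {for (x, d), continuous (fun y => h y.1 y.2)}) ->
  (forall x a d, K x -> g x (a *: d) = a ^+ 2 * g x d) ->
  (forall x a d, K x -> h x (a *: d) = a ^+ 2 * h x d) ->
  (forall x d, K x -> 0 <= h x d) ->
  (forall x d, K x -> d != 0 -> h x d = 0 -> g x d < 0) ->
  exists2 rho : R, 0 <= rho & forall x d, K x -> g x d <= rho * h x d.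
Proof.
move=> cK cg ch gZ hZ h0 gh.
pose S := [set d : 'rV[R]_m | `|d| = 1].
have cS : compact S.
  apply: bounded_closed_compact.
    by exists 1; split=> [|M M1 d /= ->]; [exact: num_real|exact: ltW].
  have -> : S = (fun d : 'rV[R]_m => `|d|) @^-1` [set 1 : R] by [].
  apply: closed_comp => [d _|]; first exact: norm_continuous.
  exact: closed_eq.
have loc (xd : V * 'rV[R]_m) : (K `*` S) xd ->
    \forall y \near xd & rho \near +oo, (K `*` S) y -> g y.1 y.2 <= rho * h y.1 y.2.
  case: xd => x d [/= Kx Sd].
  have d0 : d != 0 by rewrite -normr_gt0 Sd.
  have /cvgrPdist_lt cgx := cg x d Kx; have /cvgrPdist_lt chx := ch x d Kx.
  have := h0 x d Kx; rewrite le_eqVlt => /predU1P[hx0|hx0].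
    have gx : 0 < - g x d by rewrite oppr_gt0 gh.
    have := cgx _ gx => /= near_g.
    exists ([set y | `|g x d - g y.1 y.2| < - g x d], [set rho : R | 0 < rho]).
      by split => //; exact: nbhs_pinfty_gt.
    move=> [y rho] /= [gy rho0] [Ky _].
    apply: (@le_trans _ _ 0); last by rewrite mulr_ge0 ?h0// ltW.
    by move: gy; rewrite ltr_norml => /andP[+ _]; rewrite opprK; lra.
  have hx2 : 0 < h x d / 2 by rewrite divr_gt0.
  have near_g := cgx 1 ltr01; have near_h := chx _ hx2.
  pose rho0 := (`|g x d| + 1) / (h x d / 2).
  exists ([set y | `|g x d - g y.1 y.2| < 1 /\ `|h x d - h y.1 y.2| < h x d / 2],
          [set rho : R | rho0 < rho]).
    by split; [exact: filterI near_g near_h|apply: nbhs_pinfty_gt; exact: num_real].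
  move=> [y rho] /= [[gy hy] rr] _.
  have rho0_ge0 : 0 <= rho0 by rewrite divr_ge0 ?addr_ge0// ltW.
  have gle : g y.1 y.2 <= `|g x d| + 1.
    have := ler_norm (g x d).
    by move: gy; rewrite ltr_norml => /andP[+ _]; lra.
  have hge : h x d / 2 <= h y.1 y.2.
    by move: hy; rewrite ltr_norml => /andP[_]; lra.
  apply: le_trans gle _; apply: (@le_trans _ _ (rho0 * (h x d / 2))).
    by rewrite divfK// gt_eqF.
  by rewrite ler_pM ?(ltW hx2) ?(ltW rr).
have FF : Filter (+oo : set_system R) by exact: _.
have unif := (near_covering_withinP _).2
  ((compact_near_coveringP _).1 (compact_setX cK cS)) _ _ _ FF loc.
near (+oo : set_system R) => rho.
have rhoP : K `*` S `<=` (fun y => g y.1 y.2 <= rho * h y.1 y.2).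
  by near: rho; exact: unif.
exists rho; first by near: rho; exact: nbhs_pinfty_ge.
move=> x d Kx; have [->|d0] := eqVneq d 0.
  by rewrite -(scale0r (0 : 'rV[R]_m)) gZ// hZ// expr0n/= !mul0r mulr0.
have nd0 : `|d| != 0 by rewrite normr_eq0.
have dE : d = `|d| *: (`|d|^-1 *: d) by rewrite scalerA divff// scale1r.
rewrite dE gZ// hZ// mulrCA ler_wpM2l ?exprn_ge0//.
apply: (rhoP (x, _)); split => //=.
by rewrite /S /= normrZ normfV normr_id mulVf.
Unshelve. all: by end_near. Qed.

End Compactness.

Section ContinuouslyDifferentiable.
Context {R : realType} {n : nat}.
Notation V := ('rV[R]_n).

Lemma derive_basis (W : normedModType R) (f : V -> W) x (v : V) :
  differentiable f x ->
  'D_v f x = \sum_j v 0 j *: 'D_(delta_mx 0 j) f x.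
Proof.
move=> df; rewrite deriveE// {1}(row_sum_delta v) linear_sum.
by apply: eq_bigr => j _; rewrite linearZ/= -deriveE.
Qed.

Lemma derive_scale (W : normedModType R) (f : V -> W) x a (v : V) :
  differentiable f x -> 'D_(a *: v) f x = a *: 'D_v f x.
Proof. by move=> df; rewrite !deriveE// linearZ. Qed.

Lemma deriveDdir (W : normedModType R) (f : V -> W) x (u v : V) :
  differentiable f x -> 'D_(u + v) f x = 'D_u f x + 'D_v f x.
Proof. by move=> df; rewrite !deriveE// linearD. Qed.

Lemma continuous_derive (W : normedModType R) (U : set V) (f : V -> W) x v :
  open U -> Ck_on U 1 f -> U x ->
  {for (x, v), continuous (fun y : V * V => 'D_(y.2) f y.1)}.
Proof.
move=> Uo [df cDf] Ux.
have nU : \forall y \near (x, v), U y.1.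
  have : nbhs x U by exact: open_nbhs_nbhs.
  by move=> Ux'; exists (U, setT) => /=; [split => //; exact: filterT|case=> a b []].
have E : \forall y \near (x, v),
    \sum_j (y : V * V).2 0 j *: 'D_(delta_mx 0 j) f y.1 = 'D_(y.2) f y.1.
  by apply: filterS nU => y Uy; rewrite derive_basis//; exact: df.
rewrite /prop_for /continuous_at (derive_basis v (df x Ux)).
apply: cvg_trans (near_eq_cvg E) _.
apply: cvg_big => [|j _]; first exact: add_continuous.
apply: cvgZ.
  apply: (cvg_comp snd (fun w : V => w 0 j)); first exact: cvg_snd.
  exact: coord_continuous.
apply: (cvg_comp fst (fun y : V => 'D_(delta_mx 0 j) f y)); first exact: cvg_fst.
exact: cDf.
Qed.

Lemma cvg_derive (T : Type) (G : set_system T) {FG : Filter G}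
    (W : normedModType R) (U : set V) (f : V -> W) (x v : T -> V) x0 v0 :
  open U -> Ck_on U 1 f -> U x0 -> x t @[t --> G] --> x0 ->
  v t @[t --> G] --> v0 -> 'D_(v t) f (x t) @[t --> G] --> 'D_v0 f x0.
Proof.
move=> Uo C1f Ux0 xG vG.
apply: (cvg_comp (fun t => (x t, v t)) (fun y : V * V => 'D_(y.2) f y.1)).
  exact: (@cvg_pair _ _ _ G (nbhs x0) (nbhs v0) _ _ _ x v).
exact: continuous_derive Uo C1f Ux0.
Qed.

End ContinuouslyDifferentiable.

(** * Strict differentiability *)

Section StrictDifferentiability.
Context {R : realType} {n : nat}.
Notation V := ('rV[R]_n).

(** Subtract the derivative at [x0] and apply the mean value inequality along the
    segment from [x] to [z], on which the derivative is close to that at [x0]. *)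
Lemma strict_derive m (U : set V) (f : V -> 'rV[R]_m) x0 (eta : R) :
  open U -> Ck_on U 1 f -> U x0 -> 0 < eta ->
  exists2 r : R, 0 < r & forall x z, `|x0 - x| < r -> `|x0 - z| < r ->
    U x /\ `|f z - f x - 'D_(z - x) f x| <= eta * `|z - x|.
Proof.
move=> Uo C1f Ux0 eta0; have [df cDf] := C1f.
have eta20 : 0 < eta / 2 by rewrite divr_gt0.
have [r r0 rP] : exists2 r : R, 0 < r & forall y, `|x0 - y| < r ->
    U y /\ forall v, `|'D_v f y - 'D_v f x0| <= eta / 2 * `|v|.
  have n1 : 0 < n%:R + 1 :> R by rewrite ltr_wpDl.
  have cj (j : 'I_n) := (continuous_distP _ _).1 (cDf (delta_mx 0 j) x0 Ux0).
  have d0 : 0 < eta / 2 / (n%:R + 1) by rewrite divr_gt0.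
  have : nbhs x0 [set y | U y /\ forall j : 'I_n,
     `|'D_(delta_mx 0 j) f x0 - 'D_(delta_mx 0 j) f y| < eta / 2 / (n%:R + 1)].
    apply: filterI; first exact: open_nbhs_nbhs.
    have FF : Filter (nbhs x0) := nbhs_filter x0.
    apply: (@filter_forall _ _ _ (nbhs x0) FF) => j; apply/nbhs_distP; exact: cj.
  move=> /nbhs_distP[r r0 rP]; exists r => // y /rP[Uy yP]; split => // v.
  rewrite (derive_basis v (df y Uy)) (derive_basis v (df x0 Ux0)) -sumrB.
  under eq_bigr do rewrite -scalerBr.
  apply: le_trans (ler_norm_sum _ _ _) _.
  apply: (@le_trans _ _ (\sum_(j < n) eta / 2 / (n%:R + 1) * `|v|)).
    apply: ler_sum => j _; rewrite normrZ mulrC ler_pM ?coord_le_norm// distrC.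
    exact: ltW.
  rewrite sumr_const card_ord -[leLHS]mulr_natl.
  rewrite (_ : n%:R * _ = n%:R / (n%:R + 1) * (eta / 2 * `|v|)); last first.
    by field; rewrite gt_eqF.
  apply: ler_piMl; first by rewrite mulr_ge0// ltW.
  by rewrite ler_pdivrMr// mul1r lerDl.
exists r => // x z xr zr; have [Ux _] := rP x xr; split => //.
set v := z - x.
have seg (s : R) : 0 <= s <= 1 -> `|x0 - (x + s *: v)| < r.
  move=> /andP[s0 s1].
  have -> : x0 - (x + s *: v) = (1 - s) *: (x0 - x) + s *: (x0 - z).
    by apply/rowP => i; rewrite /v !mxE; ring.
  apply: le_lt_trans (ler_normD _ _) _.
  rewrite !normrZ (ger0_norm s0) ger0_norm ?subr_ge0//.
  have [->|s_neq0] := eqVneq s 0; first by rewrite subr0 mul1r mul0r addr0.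
  have sgt0 : 0 < s by rewrite lt_def s_neq0.
  apply: (@lt_le_trans _ _ ((1 - s) * r + s * r)); last by rewrite -mulrDl subrK mul1r.
  by rewrite ler_ltD// ?ltr_pM2l// ler_wpM2l ?subr_ge0// ltW.
have h1 : `|f z - f x - 'D_v f x0| <= eta / 2 * `|v|.
  pose w (s : R) := f (x + s *: v) - s *: 'D_v f x0.
  have dw (s : R) : 0 <= s <= 1 ->
      is_derive s 1 w ('D_v f (x + s *: v) - 'D_v f x0).
    move=> s01; apply: is_deriveB.
      have Us : U (x + s *: v) by have [] := rP _ (seg s s01).
      have dl : is_derive s (1 : R) (fun s : R => x + s *: v) v.
        apply/is_derive_mxP => i j.
        rewrite (_ : (fun y : R => _) = (fun y => x i j + v i j * y)); last first.
          by apply/funext => y; rewrite !mxE mulrC.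
        apply: is_derive_eq (is_deriveD (is_derive_cst (x i j) s 1)
          (is_derive_scale (v i j) s)) _.
        exact: add0r.
      exact: (is_derive_chain (df _ Us) dl).
    apply/is_derive_mxP => i j.
    rewrite (_ : (fun y : R => _) = (fun y => 'D_v f x0 i j * y)); last first.
      by apply/funext => y; rewrite !mxE mulrC.
    exact: is_derive_scale.
  have -> : f z - f x - 'D_v f x0 = w 1 - w 0.
    rewrite /w !scale1r !scale0r addr0 subr0 addrAC /v [x + _]addrC subrK.
    by [].
  rewrite (_ : eta / 2 * `|v| = eta / 2 * `|v| * 1 - eta / 2 * `|v| * 0); last first.
    by rewrite mulr1 mulr0 subr0.
  apply: mean_value_ineq ler01 dw
    (fun t _ => is_derive_scale (eta / 2 * `|v|) t) _ => t /andP[t0 t1].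
  have [|_] := rP (x + t *: v); last exact.
  by apply: seg; rewrite !ltW.
have h2 := (rP x xr).2 v.
have -> : f z - f x - 'D_v f x = (f z - f x - 'D_v f x0) - ('D_v f x - 'D_v f x0).
  by rewrite opprB addrA subrK.
apply: le_trans (ler_normB _ _) _; apply: le_trans (lerD h1 h2) _.
by rewrite -mulrDl -splitr.
Qed.

Lemma locally_lipschitz m (U : set V) (f : V -> 'rV[R]_m) x0 :
  open U -> Ck_on U 1 f -> U x0 ->
  exists r B : R, 0 < r /\ forall x z, `|x0 - x| < r -> `|x0 - z| < r ->
    [/\ U x, `|f x| <= B & `|f z - f x| <= B * `|z - x|].
Proof.
move=> Uo C1f Ux0; have [df cDf] := C1f.
have [r1 r10 r1P] := strict_derive Uo C1f Ux0 ltr01.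
have [b [b0 cb bD]] : exists b : V -> R, [/\ forall x, 0 <= b x,
    {for x0, continuous b} & forall x v, U x -> `|'D_v f x| <= b x * `|v|].
  exists (fun x => \sum_j `|'D_(delta_mx 0 j) f x|); split.
  - by move=> x; rewrite sumr_ge0.
  - have FF : Filter (nbhs x0) := nbhs_filter x0.
    apply: cvg_big => [|j _]; first exact: add_continuous.
    by apply: cvg_norm; exact: (cDf _ x0 Ux0).
  - move=> x v Ux; rewrite (derive_basis _ (df x Ux)).
    rewrite (le_trans (ler_norm_sum _ _ _))// mulr_suml ler_sum// => j _.
    by rewrite normrZ mulrC ler_wpM2l// coord_le_norm.
have [r2 r20 r2P] := (continuous_distP _ _).1 cb _ ltr01.
have cf : {for x0, continuous f}.
  by apply: differentiable_continuous; exact: df.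
have [r3 r30 r3P] := (continuous_distP _ _).1 cf _ ltr01.
exists (Num.min r1 (Num.min r2 r3)), (`|f x0| + b x0 + 2); split.
  by rewrite !lt_min r10 r20.
move=> x z; rewrite !lt_min => /and3P[x1 x2 x3] /and3P[z1 z2 z3].
have [Ux h] := r1P x z x1 z1; split => //.
  have := r3P x x3; rewrite distrC => h3.
  rewrite -(subrK (f x0) (f x)) (le_trans (ler_normD _ _))//.
  by have := b0 x0; lra.
have bx : b x <= b x0 + 1.
  by have := ltW (r2P x x2); rewrite ler_norml lerNl opprB lerBlDl => /andP[].
have Dx := bD x (z - x) Ux.
rewrite -(subrK ('D_(z - x) f x) (f z - f x)) (le_trans (ler_normD _ _))//.
apply: le_trans (lerD h Dx) _; rewrite -mulrDl ler_wpM2r//.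
apply: le_trans (lerD (lexx 1) bx) _.
by rewrite (_ : 1 + _ = b x0 + 2) -?addrA ?lerDr//; ring.
Qed.

End StrictDifferentiability.

(** * Lipschitz extension of a vector field *)

Section LipschitzExtension.
Context {R : realType} {n : nat}.
Notation V := ('rV[R]_n).

Lemma cutoff_exists (K : set V) (r : R) : K !=set0 -> 0 < r ->
  exists chi : V -> R,
    [/\ forall x, 0 <= chi x <= 1,
        forall x y, `|chi x - chi y| <= r^-1 * `|x - y|,
        forall x y, K x -> `|y - x| < r -> chi y = 1 &
        forall y, 0 < chi y -> exists2 x, K x & `|x - y| < 2 * r].
Proof.
move=> [k0 Kk0] r0.
pose D y := [set `|y - x| | x in K]; pose dist y := inf (D y).
have D0 y : has_inf (D y).
  split; first by exists `|y - k0|; exists k0.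
  by exists 0 => _ [x _ <-].
have dist_le y x : K x -> dist y <= `|y - x|.
  by move=> Kx; apply: ge_inf; [case: (D0 y)|exists x].
have dist_tri y y' : dist y <= dist y' + `|y - y'|.
  rewrite -lerBlDr; apply: lb_le_inf; first by case: (D0 y').
  move=> _ [x Kx <-]; rewrite lerBlDl (le_trans (dist_le y x Kx))//.
  by rewrite -(subrKA y') ler_normD.
have dist_lip y y' : `|dist y - dist y'| <= `|y - y'|.
  rewrite ler_norml lerNl opprB !lerBlDl dist_tri andbT distrC.
  exact: dist_tri.
pose clip (a : R) := Num.max 0 (Num.min 1 a).
have clip01 a : 0 <= clip a <= 1.
  by rewrite le_max lexx/= ge_max ler01 ge_min lexx.
have clip_le (a b : R) : a <= b -> clip b - clip a <= b - a.
  move=> ab; rewrite /clip /Num.max /Num.min; clear - ab.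
  by case: (ltP 1 b) => ?; case: (ltP 1 a) => ?; case: ltP => ?; case: ltP => ?; lra.
have clip_mono (a b : R) : a <= b -> clip a <= clip b.
  by move=> ab; rewrite /clip; apply: le_max2 => //; exact: le_min2.
have clip_lip (a b : R) : `|clip a - clip b| <= `|a - b|.
  wlog ab : a b / a <= b => [hw|].
    have [/hw//|/ltW/hw] := leP a b.
    by rewrite distrC [`|b - a|]distrC.
  rewrite distrC [`|a - b|]distrC !ger0_norm ?subr_ge0//.
    exact: clip_le.
  exact: clip_mono.
(* equal to 1 at distance less than [r], and to 0 beyond [2 * r] *)
exists (fun y => clip (2 - dist y / r)); split => //.
- move=> x y; apply: le_trans (clip_lip _ _) _.
  have -> : 2 - dist x / r - (2 - dist y / r) = r^-1 * (dist y - dist x) by ring.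
  have ri0 : 0 <= r^-1 by rewrite invr_ge0 ltW.
  by rewrite normrM (ger0_norm ri0) ler_wpM2l// distrC.
- move=> x y Kx yx; rewrite /clip; have dr : dist y / r <= 1.
    by rewrite ler_pdivrMr// mul1r (le_trans (dist_le y x Kx))// ltW.
  have h : 1 <= 2 - dist y / r by move: dr; move: (dist y / r) => a; clear; lra.
  by rewrite (min_l h) max_r.
- move=> y; rewrite /clip lt_max ltxx/= lt_min ltr01/= subr_gt0 ltr_pdivrMr//.
  move=> dy; have e0 : 0 < 2 * r - dist y by rewrite subr_gt0.
  have [_ [x Kx <-]] := inf_adherent e0 (D0 y).
  by rewrite -/(dist y) subrKC distrC => xy; exists x.
Qed.

(** Multiplying [f] by a Lipschitz cutoff supported near [K] makes its flow
    complete without changing the orbits that stay in [K]. *)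
Lemma lipschitz_extension m (K U : set V) (f : V -> 'rV[R]_m) :
  K !=set0 -> compact K -> open U -> K `<=` U -> Ck_on U 1 f ->
  exists (F : V -> 'rV[R]_m) (L B r : R), [/\ 0 < L /\ 0 < r,
    forall x y, `|F x - F y| <= L * `|x - y|, forall x, `|F x| <= B &
    forall x z, K x -> `|z - x| < r -> F z = f z].
Proof.
move=> K0 cK Uo KU C1f.
have [s s0 sP] : exists2 s : R, 0 < s & forall x, K x -> forall z z',
    `|x - z| < s -> `|x - z'| < s ->
    `|f z| <= s^-1 /\ `|f z' - f z| <= s^-1 * `|z' - z|.
  apply: (@compact_uniform_scale _ _ _ (fun s x => forall z z',
    `|x - z| < s -> `|x - z'| < s ->
    `|f z| <= s^-1 /\ `|f z' - f z| <= s^-1 * `|z' - z|)) => //.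
  move=> x0 /KU Ux0; have [r [B [r0 rP]]] := locally_lipschitz Uo C1f Ux0.
  pose B1 := `|B| + 1; have B10 : 0 < B1 by rewrite ltr_wpDl.
  exists (Num.min (r / 2) B1^-1); first by rewrite lt_min divr_gt0// invr_gt0.
  move=> x s; rewrite !lt_min => /andP[x0r _] s0 /andP[sr sB] z z' xz xz'.
  have near y : `|x - y| < s -> `|x0 - y| < r.
    move=> xy; rewrite -(subrKA x) (le_lt_trans (ler_normD _ _))//.
    by rewrite (splitr r) ltrD// (lt_trans xy).
  have [_ fB fL] := rP z z' (near _ xz) (near _ xz').
  have BB : B <= s^-1.
    rewrite (le_trans (ler_norm B))// (@le_trans _ _ B1) ?lerDl//.
    by rewrite -[B1]invrK lef_pV2 ?posrE ?invr_gt0// ltW.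
  by rewrite (le_trans fB)// (le_trans fL)// ler_wpM2r.
have B0 : 0 <= s^-1 by rewrite invr_ge0 ltW.
pose r := s / 3; have r0 : 0 < r by rewrite divr_gt0.
have rs : 3 * r = s by rewrite /r mulrC divfK.
have [chi [chi01 chiL chi1 chi_supp]] := cutoff_exists K0 r0.
pose F x := chi x *: f x.
have FB x : `|F x| <= s^-1.
  have /andP[c0 c1] := chi01 x; rewrite /F normrZ (ger0_norm c0).
  move: c0; rewrite le_eqVlt => /predU1P[<-|c0]; first by rewrite mul0r.
  have [y Ky yx] := chi_supp x c0.
  have ys : `|y - x| < s by rewrite (lt_trans yx)// -rs ltr_pM2r// ltr_nat.
  have [fB _] := sP y Ky x x ys ys.
  by rewrite (le_trans _ fB)// ler_piMl.
have near_case x y : `|x - y| < r -> 0 < chi x ->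
    `|F x - F y| <= (s^-1 + r^-1 * s^-1) * `|x - y|.
  move=> xy cx; have [k Kk kx] := chi_supp x cx.
  have ks : `|k - x| < s by rewrite (lt_trans kx)// -rs ltr_pM2r// ltr_nat.
  have ks' : `|k - y| < s.
    rewrite -(subrKA x) (le_lt_trans (ler_normD _ _))// -rs.
    by rewrite (_ : 3 * r = 2 * r + r) ?ltrD//; ring.
  have [fB fL] := sP k Kk x y ks ks'.
  have -> : F x - F y = (chi x - chi y) *: f x - chi y *: (f y - f x).
    by apply/rowP => i; rewrite !mxE; ring.
  apply: le_trans (ler_normB _ _) _; rewrite !normrZ addrC mulrDl lerD//.
    have /andP[c0 c1] := chi01 y.
    by rewrite (ger0_norm c0) [`|x - y|]distrC (le_trans _ fL)// ler_piMl.
  by rewrite mulrAC; apply: ler_pM.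
have rB0 : 0 <= r^-1 * s^-1 by rewrite mulr_ge0// invr_ge0 ltW.
exists F, (s^-1 + 2 * (r^-1 * s^-1) + 1), s^-1, r; split=> //.
- by rewrite ltr_wpDl// addr_ge0// mulr_ge0.
- move=> x y.
  have [rxy|xyr] := leP r `|x - y|.
    apply: (@le_trans _ _ (2 * (r^-1 * s^-1) * `|x - y|)); last first.
      by rewrite ler_wpM2r// -addrA addrCA lerDl addr_ge0.
    apply: le_trans (ler_normB _ _) _; apply: le_trans (lerD (FB x) (FB y)) _.
    have -> : s^-1 + s^-1 = 2 * (r^-1 * s^-1) * r by field; rewrite !gt_eqF.
    by rewrite ler_wpM2l// mulr_ge0.
  apply: (@le_trans _ _ ((s^-1 + r^-1 * s^-1) * `|x - y|)); last first.
    by rewrite ler_wpM2r// -addrA lerD2l mulrDl mul1r -addrA lerDl addr_ge0.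
  have /andP[+ _] := chi01 x; rewrite le_eqVlt => /predU1P[cx|]; last first.
    exact: near_case.
  have /andP[+ _] := chi01 y; rewrite le_eqVlt => /predU1P[cy|cy]; last first.
    by rewrite distrC [`|x - y|]distrC; apply: near_case; rewrite // distrC.
  by rewrite /F -cx -cy !scale0r subrr normr0 mulr_ge0// addr_ge0.
- by move=> x z Kx zx; rewrite /F (chi1 x z Kx zx) scale1r.
Qed.

End LipschitzExtension.

(** * Transverse contraction forces a limit cycle *)

Section TransverseContraction.
Context {R : realType} {n : nat}.
Notation V := ('rV[R]_n).

(** Directional derivatives, unlike Jacobian matrices, restrict without change of
    shape to the two components of a composed system. *)
Lemma qform_contraction_mx (f : V -> V) (M : V -> 'M[R]_n) (l : R) x d :
  differentiable f x -> (M x)^T = M x ->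
  qform (contraction_mx f M l x) d =
    2 * bil (M x) ('D_d f x) d + bil ('D_(f x) M x) d d + l * bil (M x) d d.
Proof.
move=> df Msym; rewrite /contraction_mx -[LHS]/(bil _ d d) !bilD bilZ.
have -> : bil ((jac f x)^T *m M x) d d = bil (M x) ('D_d f x) d.
  by rewrite /bil deriveEjacobian// /jac trmxK !mulmxA.
have -> : bil (M x *m jac f x) d d = bil (M x) ('D_d f x) d.
  by rewrite [RHS]bilC// /bil deriveEjacobian// trmx_mul /jac !mulmxA.
by rewrite mulr2n mulrDl mul1r.
Qed.

Lemma solution_onW (f : V -> V) (I J : set R) x :
  J `<=` I -> solution_on f I x -> solution_on f J x.
Proof.
move=> JI [cx dx]; split; first exact: continuous_subspaceW cx.
by move=> t Jt; apply: dx; exact: (interiorS JI).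
Qed.

Lemma interior_segment (a b t : R) : (`[a, b]%classic : set R)° t -> a < t < b.
Proof.
move=> /nbhs_distP[r r0 rP].
have r2 : `|r / 2| < r.
  by rewrite ger0_norm ?divr_ge0 ?ltW// ltr_pdivrMr// mulrDr mulr1 ltrDl.
have h1 : `|t - (t - r / 2)| < r by rewrite opprB addrC subrK.
have h2 : `|t - (t + r / 2)| < r by rewrite opprD addNKr normrN.
have := rP _ h1; have := rP _ h2; rewrite /= !in_itv/= => /andP[_ tb] /andP[ta _].
have r20 : 0 < r / 2 by rewrite divr_gt0.
by rewrite (le_lt_trans ta) ?ltrBlDr ?ltrDl// (lt_le_trans _ tb)// ltrDl.
Qed.

(** [compact_finsler] turns contraction on the hyperplanes [d' M f = 0] into an
    inequality for all [d], penalized by [rho * (d' M f)^2]; it holds across the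
    zeros of [f], where no hyperplane is singled out.  This is the hypothesis of
    [asymptotic_phase], applied to the flow of a Lipschitz extension of [f], which
    agrees with [f] along the orbits that stay in [K]. *)
Theorem transverse_contracting_limit_cycle (K : set V) (f : V -> V) :
  K !=set0 -> compact K -> smoothly_path_connected K ->
  strictly_forward_invariant K f -> smooth_near K f ->
  transverse_contracting K f -> unique_stable_limit_cycle K f.
Proof.
move=> K0 cK pK invK [U [Uo KU smf]] [M [l [l0 [[UM [UMo KUM smM]] Mpos] Mcontr]]].
have [F [L [B [r [[L0 r0] FL FB Ff]]]]] := lipschitz_extension K0 cK Uo KU (smf 1%N).
have [phi [phi0 dphi phiD phic phiu]] := flow_exists L0 FL FB.
have FK x : K x -> F x = f x.
  by move=> Kx; apply: (Ff x x Kx); rewrite subrr normr0.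
have FD x v : K x -> 'D_v F x = 'D_v f x.
  move=> Kx; apply: near_eq_derive; apply/nbhs_distP; exists r => // z xz.
  by apply: (Ff x z Kx); rewrite distrC.
have ct p : continuous (phi^~ p).
  by move=> t; exact: is_derive_continuous (dphi p t).
have clK : closed K by apply: compact_closed => //; exact: norm_hausdorff.
have int_seg (T : R) p : (forall t, 0 < t < T -> F (phi t p) = f (phi t p)) ->
    solution_on f `[0, T] (phi^~ p).
  move=> Ffp; split; first exact: continuous_subspaceT.
  by move=> t /interior_segment tT; rewrite -Ffp.
(* At the first exit time the orbit is still in [K], hence near it for a while;
   there it solves the equation of [f], so it cannot exit. *)
have Kphi p t : K p -> 0 <= t -> K (phi t p).
  move=> Kp t0; apply: contrapT => nKt.
  pose S := [set s | 0 <= s /\ ~ K (phi s p)].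
  have hS : has_inf S by split; [exists t|exists 0 => s []].
  have i0 : 0 <= inf S by apply: lb_le_inf; [case: hS|move=> s []].
  have before s : 0 <= s -> s < inf S -> K (phi s p).
    move=> s0 si; apply: contrapT => nK.
    have : inf S <= s by apply: ge_inf; [case: hS|].
    by rewrite leNgt si.
  have Ki : K (phi (inf S) p).
    have [<-|ip] := eqVneq 0 (inf S); first by rewrite phi0.
    have {}i0 : 0 < inf S by rewrite lt_def eq_sym ip.
    rewrite [K](closure_id _).1// => W /nbhs_distP[d d0 dW].
    have [e e0 eP] := (continuous_distP _ _).1 (ct p (inf S)) d d0.
    pose s := Num.max 0 (inf S - e / 2).
    have e2 : 0 < e / 2 by rewrite divr_gt0.
    have si : s < inf S by rewrite gt_max i0 ltrBlDr ltrDl.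
    have s0 : 0 <= s by rewrite le_max lexx.
    exists (phi s p); split; first exact: before.
    apply/dW/eP; rewrite ger0_norm ?subr_ge0 ?(ltW si)// ltrBlDl -ltrBlDr.
    rewrite lt_max; apply/orP; right.
    by rewrite ltrD2l ltrN2 ltr_pdivrMr// mulrDr mulr1 ltrDl.
  have [e e0 eP] := (continuous_distP _ _).1 (ct p (inf S)) r r0.
  have [s [s0 nKs] se] := inf_adherent e0 hS.
  have si : inf S <= s by apply: ge_inf; [case: hS|].
  apply: nKs; have [<-|ns] := eqVneq 0 s; first by rewrite phi0.
  have s_gt0 : 0 < s by rewrite lt_def eq_sym ns.
  apply: interior_subset; apply: (invK s (phi^~ p) s_gt0 _ _ s).
  - apply: int_seg => u /andP[u0 us].
    have [ui|iu] := ltP u (inf S); first by apply: FK; exact: before (ltW u0) ui.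
    apply: (Ff _ _ Ki); rewrite distrC; apply: eP.
    rewrite ler0_norm ?subr_le0// opprB ltrBlDl.
    exact: lt_trans us _.
  - by rewrite phi0.
  - by rewrite s_gt0 lexx.
have Kint p t : K p -> 0 < t -> K° (phi t p).
  move=> Kp t0; apply: (invK t (phi^~ p) t0); rewrite ?phi0 ?t0 ?lexx//.
  by apply: int_seg => s /andP[s0 _]; apply: FK; exact: Kphi (ltW s0).
have dM x : K x -> differentiable M x by move=> /KUM; exact: (smM 1%N).1.
have df x : K x -> differentiable f x by move=> /KU; exact: (smf 1%N).1.
have Msym x : K x -> (M x)^T = M x by move=> /Mpos[].
have cM x : K x -> {for x, continuous M}.
  by move=> /dM; exact: differentiable_continuous.
have cf x : K x -> {for x, continuous f}.
  by move=> /df; exact: differentiable_continuous.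
have cfst (W : normedModType R) (g : V -> W) x (d : V) : {for x, continuous g} ->
    {for (x, d), continuous (fun y : V * V => g y.1)}.
  move=> cg; apply: (cvg_comp fst g); [exact: cvg_fst|exact: cg].
have csnd x (d : V) : {for (x, d), continuous (fun y : V * V => y.2)}.
  exact: cvg_snd.
have cbilM x d : K x -> {for (x, d), continuous (fun y : V * V => bil (M y.1) y.2 y.2)}.
  by move=> Kx; apply: cvg_bil; [exact: cfst (cM x Kx)|exact: csnd..].
have [||||||m0 m00 m0P] := @compact_finsler _ _ _ K (fun _ d => bil 1%:M d d)
    (fun x d => bil (M x) d d) cK.
- by move=> x d Kx; apply: cvg_bil; [exact: cvg_cst|exact: csnd..].
- exact: cbilM.
- by move=> x a d _; exact: bilZZ.
- by move=> x a d _; exact: bilZZ.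
- move=> x d /Mpos[_ pos]; have [->|d0] := eqVneq d 0; first by rewrite bil0l.
  exact/ltW/pos.
- move=> x d /Mpos[_ pos] d0 M0; have := pos d d0.
  by rewrite -[qform _ _]/(bil _ _ _) M0 ltxx.
have m1 : 0 < m0 + 1 by rewrite ltr_wpDl.
have Mm x d : K x -> (m0 + 1)^-1 * `|d| ^+ 2 <= bil (M x) d d.
  move=> Kx; rewrite mulrC ler_pdivrMr//.
  apply: le_trans (norm_sqr_le_bil1 d) _; apply: le_trans (m0P x d Kx) _.
  rewrite mulrC ler_wpM2l ?lerDl//.
  have [_ pos] := Mpos x Kx; have [->|d0] := eqVneq d 0; first by rewrite bil0l.
  exact/ltW/pos.
have cDf x d : K x -> {for (x, d), continuous (fun y : V * V => 'D_(y.2) f y.1)}.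
  by move=> /KU Ux; exact: continuous_derive Uo (smf 1%N) Ux.
have cDM x d : K x -> {for (x, d), continuous (fun y : V * V => 'D_(f y.1) M y.1)}.
  move=> Kx; apply: cvg_derive UMo (smM 1%N) (KUM x Kx) _ _; first exact: cvg_fst.
  exact: (cfst _ f x d (cf x Kx)).
have [||||||rho rho0 rhoP] := @compact_finsler _ _ _ K
    (fun x d => 2 * bil (M x) ('D_d f x) d + bil ('D_(f x) M x) d d
                + l / 2 * bil (M x) d d)
    (fun x d => bil (M x) d (f x) ^+ 2) cK.
- move=> x d Kx; apply: cvgD.
    apply: cvgD.
      apply: cvgM; first exact: cvg_cst.
      by apply: cvg_bil; [exact: cfst (cM x Kx)|exact: cDf|exact: csnd].
    by apply: cvg_bil; [exact: cDM|exact: csnd..].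
  by apply: cvgM; [exact: cvg_cst|exact: cbilM].
- move=> x d Kx; apply: cvgM; apply: cvg_bil; by [exact: cfst (cM x Kx)|
    exact: csnd|exact: cfst (cf x Kx)].
- move=> x a d Kx /=; rewrite (derive_scale _ _ (df x Kx)) !bilZZ bilZl bilZr; ring.
- by move=> x a d Kx /=; rewrite bilZl exprMn.
- by move=> x d _; exact: sqr_ge0.
- move=> x d Kx d0 /eqP; rewrite sqrf_eq0 => /eqP fd.
  have := Mcontr x Kx d fd.
  rewrite (qform_contraction_mx _ _ (df x Kx) (Msym x Kx)).
  have [_ /(_ d d0)] := Mpos x Kx; rewrite -[qform _ _]/(bil _ _ _).
  move: (bil (M x) ('D_d f x) d) (bil ('D_(f x) M x) d d) => b1 b2 b3 h.
  have h2 : 0 < l / 2 * bil (M x) d d by rewrite mulr_gt0// divr_gt0.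
  have {}h : 2 * b1 + b2 + (l / 2 * bil (M x) d d + l / 2 * bil (M x) d d) <= 0.
    by rewrite -mulrDl -splitr.
  by move: h h2; move: (_ * bil _ _ _) => b4; clear; lra.
have [D [_ KD]] := compact_bounded cK.
have cMK : {within K, continuous M}.
  by apply: continuous_in_subspaceT => x; rewrite inE => /cM.
have [Mb [_ KMb]] := compact_bounded (continuous_compact cMK cK).
have l20 : 0 < l / 2 by rewrite divr_gt0.
have [e [C [k [e0 C0 k0 AP]]]] : exists e C k : R, [/\ 0 < e, 0 <= C, 0 < k &
    forall p q, K p -> `|q - p| < e -> exists2 s, `|s| <= C * `|q - p| &
      forall t, 0 <= t ->
        `|phi (t + s) q - phi t p| <= C * `|q - p| * expR (- k * t)].
  apply: (@asymptotic_phase _ _ K F phi M L B (D + 1) (m0 + 1)^-1 (Mb + 1)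
    (l / 2) rho) => //.
  - exact: ltW.
  - by move=> x Kx; apply: KD; rewrite ?ltrDl.
  - by rewrite invr_gt0.
  - by move=> x Kx; apply: KMb; [rewrite ltrDl|exists x].
  - move=> eta eta0.
    have [|s s0 sP] := compact_uniform_scale (P := fun s x => forall z,
        `|z - x| < s -> `|f z - f x - 'D_(z - x) f x| <= eta * `|z - x|) cK.
      move=> x0 /KU Ux0.
      have [d d0 dP] := strict_derive Uo (smf 1%N) Ux0 eta0.
      exists (d / 2) => [|x s xs s0 sd z zx]; first by rewrite divr_gt0.
      have d2 : d / 2 < d by rewrite ltr_pdivrMr// mulrDr mulr1 ltrDl.
      have [||_] // := dP x z; first exact: lt_trans d2.
      rewrite -(subrKA x) (le_lt_trans (ler_normD _ _))// (splitr d) ltrD//.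
      by rewrite distrC (lt_trans zx).
    exists (Num.min s r) => [|x z Kx]; first by rewrite lt_min s0.
    rewrite lt_min => /andP[zs zr]; rewrite (FD x _ Kx) (FK x Kx) (Ff x z Kx zr).
    exact: sP.
  - by move=> x d Kx; rewrite FD// FK//; exact: rhoP.
apply: (limit_cycle_of_asymptotic_phase (phi := phi) (e := e) (C := C) (k := k)) => //.
- exact: path_connected_connected.
- move=> x xsol Kx t; rewrite le_eqVlt => /predU1P[<-|t0]; first by rewrite phi0.
  have sub : `[0, t] `<=` (`[0, +oo[ : set R).
    by move=> s; rewrite /= !in_itv/= => /andP[->].
  have xt := solution_onW sub xsol.
  have Kxs s : 0 < s <= t -> K (x s).
    by move=> st; apply: interior_subset; exact: invK t x t0 xt Kx s st.
  apply: (phiu t); last by rewrite ltW/=.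
    by have [] := xt.
  move=> s /andP[s0 st]; rewrite FK; last by apply: Kxs; rewrite s0 ltW.
  have [_ dx] := xt; apply: dx; apply/nbhs_distP.
  exists (Num.min s (t - s)) => [|u]; first by rewrite lt_min s0 subr_gt0.
  rewrite lt_min !ltr_norml /= in_itv/= => /andP[/andP[h1 h2] /andP[h3 h4]].
  by apply/andP; split; lra.
- move=> p Kp; split; first by apply: continuous_subspaceT; exact: ct.
  by move=> t _; rewrite -FK.
Qed.

End TransverseContraction.

(** * Calculus of maps of class C^k *)

Section SmoothCalculus.
Context {R : realType} {V : normedModType R}.
Implicit Type U : set V.

Lemma near_eq_differentiable (W : normedModType R) (f g : V -> W) x :
  (\near x, f x = g x) -> differentiable f x -> differentiable g x.
Proof.
move=> fg df; have fgx : f x = g x := nbhs_singleton fg.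
have /nbhs_distP[d d0 dP] := fg.
have gE : g \o shift x = cst (g x) + 'd f x +o_ (0 : V) id.
  apply/eqaddoP => e e0; have /eqaddoP/(_ e e0) := diff_locally df.
  have small : \forall h \near (0 : V), `|h| < d.
    by apply/nbhs_distP; exists d => // y; rewrite sub0r normrN.
  apply: filterS2 small => h hd fo; move: fo.
  have fgh : f (h + x) = g (h + x).
    by apply: dP; rewrite opprD addrCA subrr addr0 normrN.
  rewrite -[(f \o shift x - _) h]/(f (h + x) - (f x + 'd f x h)).
  by rewrite -[(g \o shift x - _) h]/(g (h + x) - (g x + 'd f x h)) fgh fgx.
have dgE := diff_unique (diff_continuous df) gE.
by apply/diff_locallyP; rewrite dgE; split => //; exact: diff_continuous.
Qed.

Lemma Ck_on_sub (W : normedModType R) U U' k (f : V -> W) :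
  U' `<=` U -> Ck_on U k f -> Ck_on U' k f.
Proof.
move=> U'U; elim: k f => [|k ih] f /=; first by move=> cf x /U'U; exact: cf.
by move=> [df Df]; split=> [x /U'U|v]; [exact: df|exact: ih].
Qed.

Lemma Ck_onS (W : normedModType R) U k (f : V -> W) :
  Ck_on U k.+1 f -> Ck_on U k f.
Proof.
elim: k f => [|k ih] f [df Df].
  by move=> x /df; exact: differentiable_continuous.
by split => // v; apply: ih; exact: Df.
Qed.

(** The rules for ['D_v] of sums, products and components only hold on [U]; this
    lemma lets them be used under the recursion that defines [Ck_on]. *)
Lemma Ck_on_ext (W : normedModType R) U k (f g : V -> W) : open U ->
  (forall x, U x -> f x = g x) -> Ck_on U k f -> Ck_on U k g.
Proof.
move=> Uo; elim: k f g => [|k ih] f g fg.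
  move=> cf x Ux; have nfg : \near x, f x = g x.
    by apply: filterS (open_nbhs_nbhs (conj Uo Ux)) => y; exact: fg.
  rewrite /prop_for /continuous_at -fg//.
  by apply: cvg_trans (near_eq_cvg nfg) _; exact: cf.
have nfg x : U x -> \near x, f x = g x.
  by move=> Ux; apply: filterS (open_nbhs_nbhs (conj Uo Ux)) => y; exact: fg.
move=> [df Df]; split=> [x Ux|v].
  exact: near_eq_differentiable (nfg x Ux) (df x Ux).
apply: ih (Df v) => x Ux; exact: near_eq_derive (nfg x Ux).
Qed.

Lemma Ck_on_cst (W : normedModType R) U k (a : W) : Ck_on U k (fun=> a).
Proof.
elim: k a => [|k ih] a; first by move=> x _; exact: cvg_cst.
split=> [x _|v]; first exact: differentiable_cst.
have -> : (fun x => 'D_v (fun=> a) x) = (fun=> 0).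
  by apply/funext => x; exact: derive_cst.
exact: ih.
Qed.

Lemma Ck_onD (W : normedModType R) U k (f g : V -> W) : open U ->
  Ck_on U k f -> Ck_on U k g -> Ck_on U k (fun x => f x + g x).
Proof.
move=> Uo; elim: k f g => [|k ih] f g.
  by move=> cf cg x Ux; apply: cvgD; [exact: cf|exact: cg].
move=> [df Df] [dg Dg]; split=> [x Ux|v].
  exact: differentiableD (df x Ux) (dg x Ux).
apply: Ck_on_ext Uo _ (ih _ _ (Df v) (Dg v)) => x Ux.
by rewrite deriveD//; apply: diff_derivable; [exact: df|exact: dg].
Qed.

Lemma Ck_on_sum (W : normedModType R) U k m (F : 'I_m -> V -> W) : open U ->
  (forall i, Ck_on U k (F i)) -> Ck_on U k (fun x => \sum_i F i x).
Proof.
move=> Uo FC; rewrite -[fun x => _]/(fun x => \big[+%R/0]_(i <- _ | _) F i x).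
elim: (index_enum _) => [|i s ih].
  by apply: Ck_on_ext Uo _ (Ck_on_cst U k 0) => x _; rewrite big_nil.
by apply: Ck_on_ext Uo _ (Ck_onD Uo (FC i) ih) => x _; rewrite big_cons.
Qed.

Lemma Ck_onM U k (f g : V -> R) : open U ->
  Ck_on U k f -> Ck_on U k g -> Ck_on U k (fun x => f x * g x).
Proof.
move=> Uo; elim: k f g => [|k ih] f g.
  by move=> cf cg x Ux; apply: cvgM; [exact: cf|exact: cg].
move=> fC gC; have [df Df] := fC; have [dg Dg] := gC; split=> [x Ux|v].
  exact: differentiableM (df x Ux) (dg x Ux).
apply: Ck_on_ext Uo _ (Ck_onD Uo (ih _ _ (Ck_onS fC) (Dg v))
                               (ih _ _ (Ck_onS gC) (Df v))) => x Ux.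
by rewrite deriveM//; apply: diff_derivable; [exact: df|exact: dg].
Qed.

Lemma Ck_onX U k (f : V -> R) m : open U ->
  Ck_on U k f -> Ck_on U k (fun x => f x ^+ m).
Proof.
move=> Uo fC; elim: m => [|m ih]; first exact: Ck_on_cst.
by apply: Ck_on_ext Uo _ (Ck_onM Uo fC ih) => x _; rewrite exprS.
Qed.

Lemma differentiable_mxP m n (A : V -> 'M[R]_(m, n)) x :
  differentiable A x <-> forall i j, differentiable (fun y => A y i j) x.
Proof.
split=> [dA i j|dA].
  exact: (differentiable_comp dA (differentiable_coord (A x) i j)).
have -> : A = \sum_i \sum_j (fun y => A y i j *: (delta_mx i j : 'M[R]_(m, n))).
  apply/funext => y; rewrite fct_sumE {1}[A y]matrix_sum_delta.
  by apply: eq_bigr => i _; rewrite fct_sumE.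
apply: differentiable_sum => i; apply: differentiable_sum => j.
exact: differentiableZl.
Qed.

Lemma Ck_on_mxP U k m n (A : V -> 'M[R]_(m, n)) : open U ->
  Ck_on U k A <-> forall i j, Ck_on U k (fun x => A x i j).
Proof.
move=> Uo; elim: k A => [|k ih] A.
  split=> [cA i j x Ux|cA x Ux].
    by have /cvg_mxP := cA x Ux; exact.
  have FF : Filter (nbhs x) := nbhs_filter x.
  by apply/cvg_mxP => i j; exact: cA.
split=> [[dA DA] i j|CA].
  split=> [x Ux|v]; first by have /differentiable_mxP := dA x Ux; exact.
  apply: Ck_on_ext Uo _ ((ih _).1 (DA v) i j) => x Ux.
  by rewrite derive_mx ?mxE//; exact: diff_derivable (dA x Ux).
have dA x : U x -> differentiable A x.
  by move=> Ux; apply/differentiable_mxP => i j; exact: (CA i j).1.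
split => // v; apply/ih => i j; have [_ /(_ v)] := CA i j.
apply: Ck_on_ext Uo _ => x Ux.
by rewrite derive_mx ?mxE//; exact: diff_derivable (dA x Ux).
Qed.

Lemma Ck_on_bil U k m n (Q : V -> 'M[R]_(m, n)) u v : open U ->
  Ck_on U k Q -> Ck_on U k u -> Ck_on U k v ->
  Ck_on U k (fun x => bil (Q x) (u x) (v x)).
Proof.
move=> Uo /(Ck_on_mxP _ _ Uo) QC /(Ck_on_mxP _ _ Uo) uC /(Ck_on_mxP _ _ Uo) vC.
have SC := Ck_on_sum Uo (fun i => Ck_on_sum Uo (fun j =>
  Ck_onM Uo (Ck_onM Uo (uC 0 i) (QC i j)) (vC 0 j))).
by apply: Ck_on_ext Uo _ SC => x _; rewrite bilE.
Qed.

Lemma Ck_on_scale U k m n (a : V -> R) (A : V -> 'M[R]_(m, n)) : open U ->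
  Ck_on U k a -> Ck_on U k A -> Ck_on U k (fun x => a x *: A x).
Proof.
move=> Uo aC /(Ck_on_mxP _ _ Uo) AC; apply/(Ck_on_mxP _ _ Uo) => i j.
by apply: Ck_on_ext Uo _ (Ck_onM Uo aC (AC i j)) => x _; rewrite mxE.
Qed.

End SmoothCalculus.

Section LinearReparametrization.
Context {R : realType} {V V' : normedModType R}.

Lemma derive_linear_comp (W : normedModType R) (f : V -> W) (L : {linear V' -> V}) x v :
  'D_v (fun y => f (L y)) x = 'D_(L v) f (L x).
Proof.
have E : (fun h : R => h^-1 *: (((fun y => f (L y)) \o shift x) (h *: v) - f (L x)))
    = (fun h : R => h^-1 *: ((f \o shift (L x)) (h *: L v) - f (L x))).
  by apply/funext => h /=; rewrite (linearP L h v x).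
by rewrite /derive E.
Qed.

Lemma Ck_on_linear_comp (W : normedModType R) (U : set V) k (f : V -> W)
    (L : {linear V' -> V}) : open U -> continuous L ->
  Ck_on U k f -> Ck_on (L @^-1` U) k (fun x => f (L x)).
Proof.
move=> Uo cL.
have LUo : open (L @^-1` U) by apply: open_comp => // x _; exact: cL.
elim: k f => [|k ih] f.
  move=> cf x Ux; apply: (@continuous_comp _ _ _ L f); first exact: cL.
  exact: cf.
move=> [df Df]; split=> [x Ux|v].
  apply: (@differentiable_comp _ _ _ _ L f); last exact: df.
    exact: linear_differentiable.
apply: Ck_on_ext LUo _ (ih _ (Df (L v))) => x Ux.
by rewrite derive_linear_comp.
Qed.

End LinearReparametrization.

(** * Maps between products *)

Section BlockStructure.
Context {R : realType} {n1 n2 : nat}.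
Notation X := ('rV[R]_(n1 + n2)).
Notation inl := (fun d1 : 'rV[R]_n1 => row_mx d1 (0 : 'rV[R]_n2)).
Notation inr := (fun d2 : 'rV[R]_n2 => row_mx (0 : 'rV[R]_n1) d2).

Lemma bil_block_diag (A : 'M[R]_n1) (B : 'M[R]_n2) (u v : X) :
  bil (block_mx A 0 0 B) u v =
    bil A (lsubmx u) (lsubmx v) + bil B (rsubmx u) (rsubmx v).
Proof.
rewrite /bil -{1}(hsubmxK u) -{1}(hsubmxK v) mul_row_block !mulmx0 addr0 add0r.
by rewrite tr_row_mx mul_row_col mxE.
Qed.

Lemma derive_row_mx (V : normedModType R) (a : V -> 'rV[R]_n1) (b : V -> 'rV[R]_n2) x v :
  derivable a x v -> derivable b x v ->
  'D_v (fun y => row_mx (a y) (b y)) x = row_mx ('D_v a x) ('D_v b x).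
Proof.
move=> /derivableP/is_derive_mxP da /derivableP/is_derive_mxP db.
apply: derive_val; apply/is_derive_mxP => i j.
case: (split_ordP j) => k ->; rewrite ?row_mxEl ?row_mxEr.
  by under eq_fun do rewrite row_mxEl; exact: da.
by under eq_fun do rewrite row_mxEr; exact: db.
Qed.

Lemma cvg_row_mx (T : Type) (F : set_system T) {FF : Filter F}
    (a : T -> 'rV[R]_n1) (b : T -> 'rV[R]_n2)
    (a0 : 'rV[R]_n1) (b0 : 'rV[R]_n2) :
  a t @[t --> F] --> a0 -> b t @[t --> F] --> b0 ->
  row_mx (a t) (b t) @[t --> F] --> row_mx a0 b0.
Proof.
move=> /cvg_mxP ca /cvg_mxP cb; apply/cvg_mxP => i j.
case: (split_ordP j) => k ->; rewrite ?row_mxEl ?row_mxEr.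
  by under eq_fun do rewrite row_mxEl; exact: ca.
by under eq_fun do rewrite row_mxEr; exact: cb.
Qed.

Lemma Ck_on_row_mx (V : normedModType R) (U : set V) k (a : V -> 'rV[R]_n1)
    (b : V -> 'rV[R]_n2) : open U -> Ck_on U k a -> Ck_on U k b ->
  Ck_on U k (fun x => row_mx (a x) (b x)).
Proof.
move=> Uo /(Ck_on_mxP _ _ Uo) aC /(Ck_on_mxP _ _ Uo) bC.
apply/(Ck_on_mxP _ _ Uo) => i j; case: (split_ordP j) => h ->.
  by apply: Ck_on_ext Uo _ (aC i h) => x _; rewrite row_mxEl.
by apply: Ck_on_ext Uo _ (bC i h) => x _; rewrite row_mxEr.
Qed.

Lemma Ck_on_block_diag (V : normedModType R) (U : set V) k (A : V -> 'M[R]_n1)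
    (B : V -> 'M[R]_n2) : open U -> Ck_on U k A -> Ck_on U k B ->
  Ck_on U k (fun x => block_mx (A x) 0 0 (B x)).
Proof.
move=> Uo /(Ck_on_mxP _ _ Uo) aC /(Ck_on_mxP _ _ Uo) bC.
apply/(Ck_on_mxP _ _ Uo) => i j.
case: (split_ordP i) => i' ->; case: (split_ordP j) => j' ->.
- by apply: Ck_on_ext Uo _ (aC i' j') => x _; rewrite block_mxEul.
- by apply: Ck_on_ext Uo _ (Ck_on_cst U k 0) => x _; rewrite block_mxEur mxE.
- by apply: Ck_on_ext Uo _ (Ck_on_cst U k 0) => x _; rewrite block_mxEdl mxE.
- by apply: Ck_on_ext Uo _ (bC i' j') => x _; rewrite block_mxEdr.
Qed.

Lemma row_mx_sum (d1 : 'rV[R]_n1) (d2 : 'rV[R]_n2) : row_mx d1 d2 = inl d1 + inr d2.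
Proof. by rewrite add_row_mx addr0 add0r. Qed.

Lemma derive_partial_r (W : normedModType R) (g : 'rV[R]_n1 -> 'rV[R]_n2 -> W)
    (x : X) (d2 : 'rV[R]_n2) :
  'D_d2 (g (lsubmx x)) (rsubmx x) = 'D_(inr d2) (uncurry_row g) x.
Proof.
have E : (fun h : R => h^-1 *: ((g (lsubmx x) \o shift (rsubmx x)) (h *: d2)
      - g (lsubmx x) (rsubmx x)))
    = (fun h : R => h^-1 *: ((uncurry_row g \o shift x) (h *: inr d2) - uncurry_row g x)).
  apply/funext => h /=; rewrite /uncurry_row !linearD !linearZ/=.
  by rewrite row_mxKl row_mxKr scaler0 add0r.
by rewrite /derive E.
Qed.

Lemma differentiable_partial_r (W : normedModType R) (g : 'rV[R]_n1 -> 'rV[R]_n2 -> W)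
    (x : X) : differentiable (uncurry_row g) x ->
  differentiable (g (lsubmx x)) (rsubmx x).
Proof.
move=> dg; pose L (y : 'rV[R]_n2) : X := row_mx (lsubmx x) y.
have -> : g (lsubmx x) = uncurry_row g \o L.
  by apply/funext => y; rewrite /= /uncurry_row row_mxKl row_mxKr.
have Lx : L (rsubmx x) = x by rewrite /L hsubmxK.
apply: differentiable_comp; last by rewrite Lx.
apply/differentiable_mxP => i j; case: (split_ordP j) => k ->.
  rewrite (_ : (fun y => _) = cst (lsubmx x i k)); first exact: differentiable_cst.
  by apply/funext => y; rewrite row_mxEl.
rewrite (_ : (fun y => _) = (fun y : 'rV[R]_n2 => y i k)).
  exact: differentiable_coord.
by apply/funext => y; rewrite row_mxEr.
Qed.

Lemma posdef_bil_ge0 n (Q : 'M[R]_n) d : posdef Q -> 0 <= bil Q d d.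
Proof.
by move=> [_ pos]; have [->|d0] := eqVneq d 0; [rewrite bil0l|exact/ltW/pos].
Qed.

Lemma posdef_bil_eq0 n (Q : 'M[R]_n) d : posdef Q -> bil Q d d = 0 -> d = 0.
Proof.
move=> [_ pos] Qd; apply: contra_eq Qd => d0.
by have := pos d d0; rewrite -[qform _ _]/(bil _ _ _) => /gt_eqF ->.
Qed.

End BlockStructure.

(** * The metric of the composed system *)

Section HierarchicalMetric.
Context {R : realType} {n1 n2 : nat}.
Notation X := ('rV[R]_(n1 + n2)).
Notation inl := (fun d1 : 'rV[R]_n1 => row_mx d1 (0 : 'rV[R]_n2)).
Notation inr := (fun d2 : 'rV[R]_n2 => row_mx (0 : 'rV[R]_n1) d2).

(** The metric is [(1 + V)^N] times the block diagonal matrix of [al * M1] and [M2],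
    where [V = f1' M1 f1] decreases along the flow: its derivative is at most
    [- l1 * V].  The quantities [E1] and [E2] are the energies of the two blocks and
    [S = al * E1 + E2].  In the derivative of [S] three terms are harmful.
    - The coupling [cross] through the derivative of [f2] in the first variable is
      at most a quarter of the decay of [E2] plus [kap * E1], and a large [al] makes
      the decay of [al * E1] absorb the latter.
    - The condition on [d] involves both blocks: it makes [d2' M2 f2] equal to
      [- al * d1' M1 f1] instead of 0, so that the penalty of Finsler's lemma for
      the second system is [rho * (al * d1' M1 f1)^2].
    - [M2] depends on the first variable, which moves with velocity [f1]: [drift].
    The last two vanish with [f1].  They are therefore dominated by part of the
    remaining decay plus a multiple of [V / (1 + V) * S]; differentiating the factor
    [(1 + V)^N] yields, relative to it, at most [- N * l1 * V / (1 + V) * S], which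
    compensates that multiple for [N] large. *)
Lemma transverse_contracting_of_blocks (K U : set X) (f1 : X -> 'rV[R]_n1)
    (f2 : X -> 'rV[R]_n2) (M1 : X -> 'M[R]_n1) (M2 : X -> 'M[R]_n2) (l1 l2 : R)
    (f := fun x => row_mx (f1 x) (f2 x)) :
  compact K -> open U -> K `<=` U ->
  (forall k, Ck_on U k f1) -> (forall k, Ck_on U k f2) ->
  (forall k, Ck_on U k M1) -> (forall k, Ck_on U k M2) ->
  (forall x, K x -> posdef (M1 x)) -> (forall x, K x -> posdef (M2 x)) ->
  0 < l1 -> 0 < l2 ->
  (forall x d, K x ->
     2 * bil (M1 x) ('D_d f1 x) (lsubmx d) + bil ('D_(f x) M1 x) (lsubmx d) (lsubmx d)
       + l1 * bil (M1 x) (lsubmx d) (lsubmx d) <= 0) ->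
  (forall x (d2 : 'rV[R]_n2), K x -> bil (M2 x) d2 (f2 x) = 0 ->
     2 * bil (M2 x) ('D_(inr d2) f2 x) d2 + bil ('D_(inr (f2 x)) M2 x) d2 d2
       + l2 * bil (M2 x) d2 d2 <= 0) ->
  transverse_contracting K f.
Proof.
move=> cK Uo KU sf1 sf2 sM1 sM2 pM1 pM2 l10 l20 contr1 contr2.
have df1 x : K x -> differentiable f1 x by move=> /KU; exact: (sf1 1%N).1.
have df2 x : K x -> differentiable f2 x by move=> /KU; exact: (sf2 1%N).1.
have dM1 x : K x -> differentiable M1 x by move=> /KU; exact: (sM1 1%N).1.
have dM2 x : K x -> differentiable M2 x by move=> /KU; exact: (sM2 1%N).1.
have cf1 x : K x -> {for x, continuous f1}.
  by move=> /df1; exact: differentiable_continuous.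
have cf2 x : K x -> {for x, continuous f2}.
  by move=> /df2; exact: differentiable_continuous.
have cM1 x : K x -> {for x, continuous M1}.
  by move=> /dM1; exact: differentiable_continuous.
have cM2 x : K x -> {for x, continuous M2}.
  by move=> /dM2; exact: differentiable_continuous.
have cfst (W W' : normedModType R) (g : X -> W) x (d : W') : {for x, continuous g} ->
    g y.1 @[y --> (x, d)] --> g x.
  by move=> cg; apply: (cvg_comp fst g); [exact: cvg_fst|exact: cg].
have csnd (W : normedModType R) (x : X) (d : W) : y.2 @[y --> (x, d)] --> d.
  exact: cvg_snd.
have cl (x d : X) : lsubmx y.2 @[y --> (x, d)] --> lsubmx d.
  by apply: (cvg_comp snd lsubmx); [exact: cvg_snd|exact: continuous_lsubmx].
have cr (x d : X) : rsubmx y.2 @[y --> (x, d)] --> rsubmx d.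
  by apply: (cvg_comp snd rsubmx); [exact: cvg_snd|exact: continuous_rsubmx].
pose E1 x (d : X) := bil (M1 x) (lsubmx d) (lsubmx d).
pose E2 x (d : X) := bil (M2 x) (rsubmx d) (rsubmx d).
pose V x := bil (M1 x) (f1 x) (f1 x).
have E10 x d : K x -> 0 <= E1 x d by move=> /pM1; exact: posdef_bil_ge0.
have E20 x d : K x -> 0 <= E2 x d by move=> /pM2; exact: posdef_bil_ge0.
have V0 x : K x -> 0 <= V x by move=> /pM1; exact: posdef_bil_ge0.
have E12_gt0 x d : K x -> d != 0 -> E1 x d = 0 -> 0 < E2 x d.
  move=> Kx d0 /(posdef_bil_eq0 (pM1 x Kx)) d10; have [_] := pM2 x Kx; apply.
  by apply: contra_neq d0 => d20; rewrite -[d]hsubmxK d10 d20 row_mx0.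
have cE1 x d : K x -> E1 y.1 y.2 @[y --> (x, d)] --> E1 x d.
  by move=> Kx; apply: cvg_bil; [exact: cfst (cM1 x Kx)|exact: cl..].
have cE2 x d : K x -> E2 y.1 y.2 @[y --> (x, d)] --> E2 x d.
  by move=> Kx; apply: cvg_bil; [exact: cfst (cM2 x Kx)|exact: cr..].
have cV x (d : X) : K x -> V y.1 @[y --> (x, d)] --> V x.
  by move=> Kx; apply: cvg_bil; [exact: cfst (cM1 x Kx)|exact: cfst (cf1 x Kx)..].
pose T2 x d2 := 2 * bil (M2 x) ('D_(inr d2) f2 x) d2 + bil ('D_(inr (f2 x)) M2 x) d2 d2.
pose cross x (d : X) := 2 * bil (M2 x) ('D_(inl (lsubmx d)) f2 x) (rsubmx d).
pose drift x (d : X) := bil ('D_(inl (f1 x)) M2 x) (rsubmx d) (rsubmx d).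
have inlZ a d : inl (a *: d) = a *: inl d by rewrite /= scale_row_mx scaler0.
have lsubZ a (d : X) : lsubmx (a *: d) = a *: lsubmx d by rewrite linearZ.
have rsubZ a (d : X) : rsubmx (a *: d) = a *: rsubmx d by rewrite linearZ.
have inrZ a d : inr (a *: d) = a *: inr d by rewrite /= scale_row_mx scaler0.
have [||||||rho rho0 rhoP] := @compact_finsler _ _ _ K
    (fun x d2 => T2 x d2 + l2 / 2 * bil (M2 x) d2 d2)
    (fun x d2 => bil (M2 x) d2 (f2 x) ^+ 2) cK.
- move=> x d Kx; apply: cvgD; last first.
    apply: cvgM; first exact: cvg_cst.
    by apply: cvg_bil; [exact: cfst (cM2 x Kx)|exact: csnd..].
  apply: cvgD.
    apply: cvgM; first exact: cvg_cst.
    apply: cvg_bil; [exact: cfst (cM2 x Kx)| |exact: csnd].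
    apply: cvg_derive Uo (sf2 1%N) (KU x Kx) _ _; first exact: cvg_fst.
    by apply: cvg_row_mx; [exact: cvg_cst|exact: csnd].
  apply: cvg_bil; [|exact: csnd..].
  apply: cvg_derive Uo (sM2 1%N) (KU x Kx) _ _; first exact: cvg_fst.
  by apply: cvg_row_mx; [exact: cvg_cst|exact: cfst (cf2 x Kx)].
- by move=> x d Kx; apply: cvgM; apply: cvg_bil; by [exact: cfst (cM2 x Kx)|
    exact: csnd|exact: cfst (cf2 x Kx)].
- move=> x a d Kx /=; rewrite /T2 inrZ (derive_scale _ _ (df2 x Kx)) !bilZZ bilZl bilZr.
  ring.
- by move=> x a d Kx /=; rewrite bilZl exprMn.
- by move=> x d _; exact: sqr_ge0.
- move=> x d Kx d0 /eqP; rewrite sqrf_eq0 => /eqP fd.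
  have := contr2 x d Kx fd; rewrite -/(T2 x d) => h.
  have := (pM2 x Kx).2 d d0; rewrite -[qform _ _]/(bil _ _ _) => M2d.
  apply: lt_le_trans h; rewrite ltrD2l ltr_pM2r//.
  by rewrite ltr_pdivrMr// mulrDr mulr1 ltrDl.
have [||||||kap kap0 kapP] := @compact_finsler _ _ _ K
    (fun x d => cross x d - l2 / 4 * E2 x d) E1 cK.
- move=> x d Kx; apply: cvgB; last by apply: cvgM; [exact: cvg_cst|exact: cE2].
  apply: cvgM; first exact: cvg_cst.
  apply: cvg_bil; [exact: cfst (cM2 x Kx)| |exact: cr].
  apply: cvg_derive Uo (sf2 1%N) (KU x Kx) _ _; first exact: cvg_fst.
  by apply: cvg_row_mx; [exact: cl|exact: cvg_cst].
- exact: cE1.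
- move=> x a d Kx /=; rewrite /cross /E2 ?lsubZ ?rsubZ inlZ (derive_scale _ _ (df2 x Kx)).
  rewrite bilZZ bilZl bilZr; ring.
- by move=> x a d Kx /=; rewrite /E1 ?lsubZ ?rsubZ bilZZ.
- by move=> x d; exact: E10.
- move=> x d Kx d0 Ed; have := E12_gt0 x d Kx d0 Ed.
  rewrite /cross (posdef_bil_eq0 (pM1 x Kx) Ed) row_mx0 derive0 bil0l mulr0 sub0r.
  by rewrite oppr_lt0 => E2x; rewrite mulr_gt0// divr_gt0.
pose al := (kap + 1) / l1.
have al0 : 0 < al by rewrite divr_gt0// ltr_wpDl.
pose lam := Num.min (2 * al)^-1 (l2 / 8).
have lam0 : 0 < lam by rewrite lt_min invr_gt0 mulr_gt0// divr_gt0.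
pose S x d := al * E1 x d + E2 x d.
have S0 x d : K x -> 0 <= S x d.
  by move=> Kx; rewrite addr_ge0 ?E20// mulr_ge0 ?E10// ltW.
have cS x d : K x -> S y.1 y.2 @[y --> (x, d)] --> S x d.
  by move=> Kx; apply: cvgD; [apply: cvgM; [exact: cvg_cst|exact: cE1]|exact: cE2].
have S_gt0 x d : K x -> d != 0 -> 0 < S x d.
  move=> Kx d0; have := E10 x d Kx; rewrite le_eqVlt => /predU1P[/esym Ed|Ed].
    by rewrite /S Ed mulr0 add0r; exact: E12_gt0.
  by rewrite ltr_wpDr ?E20// mulr_gt0.
have lamS x d : K x -> lam * S x d <= 1 / 2 * E1 x d + l2 / 8 * E2 x d.
  move=> Kx; rewrite /S mulrDr lerD//; last by rewrite ler_wpM2r ?E20// ge_min lexx orbT.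
  rewrite mulrA ler_wpM2r ?E10//.
  apply: (@le_trans _ _ ((2 * al)^-1 * al)).
    by rewrite ler_wpM2r ?(ltW al0)// ge_min lexx.
  by rewrite invfM -mulrA mulVf ?gt_eqF// mulr1 div1r.
pose g x d := rho * (al * bil (M1 x) (lsubmx d) (f1 x)) ^+ 2 + drift x d + lam * S x d
  - E1 x d - l2 / 4 * E2 x d.
have V1 x : K x -> 0 < 1 + V x by move=> Kx; rewrite ltr_pwDl// V0.
have [||||||nu nu0 nuP] := @compact_finsler _ _ _ K g
    (fun x d => V x / (1 + V x) * S x d) cK.
- move=> x d Kx; apply: cvgB; last by apply: cvgM; [exact: cvg_cst|exact: cE2].
  apply: cvgB; last exact: cE1.
  apply: cvgD; last by apply: cvgM; [exact: cvg_cst|exact: cS].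
  apply: cvgD.
    apply: cvgM; first exact: cvg_cst.
    have cb1 : al * bil (M1 y.1) (lsubmx y.2) (f1 y.1) @[y --> (x, d)] -->
        al * bil (M1 x) (lsubmx d) (f1 x).
      apply: cvgM; first exact: cvg_cst.
      by apply: cvg_bil; [exact: cfst (cM1 x Kx)|exact: cl|exact: cfst (cf1 x Kx)].
    exact: (cvgM cb1 cb1).
  apply: cvg_bil; [|exact: cr..].
  apply: cvg_derive Uo (sM2 1%N) (KU x Kx) _ _; first exact: cvg_fst.
  by apply: cvg_row_mx; [exact: cfst (cf1 x Kx)|exact: cvg_cst].
- move=> x d Kx; apply: cvgM; last exact: cS.
  apply: cvgM; first exact: cV.
  apply: cvgV; first by rewrite gt_eqF// V1.
  by apply: cvgD; [exact: cvg_cst|exact: cV].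
- move=> x a d Kx; rewrite /g /drift /S /E1 /E2 ?lsubZ ?rsubZ !bilZZ bilZl; ring.
- by move=> x a d Kx; rewrite /S /E1 /E2 ?lsubZ ?rsubZ !bilZZ; ring.
- by move=> x d Kx; rewrite mulr_ge0 ?S0// divr_ge0 ?V0// ltW// V1.
- move=> x d Kx d0 /eqP; rewrite mulf_eq0 (gt_eqF (S_gt0 x d Kx d0)) orbF.
  rewrite mulf_eq0 invr_eq0 (gt_eqF (V1 x Kx)) orbF => /eqP Vx0.
  rewrite /g /drift (posdef_bil_eq0 (pM1 x Kx) Vx0) row_mx0 derive0 bil0r mulr0.
  rewrite expr0n/= mulr0 [bil 0 _ _](_ : _ = 0); last by rewrite /bil mulmx0 mul0mx mxE.
  have := lamS x d Kx; have := E10 x d Kx; have := E20 x d Kx.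
  have : 0 < 1 / 2 * E1 x d + l2 / 8 * E2 x d.
    have := E10 x d Kx; rewrite le_eqVlt => /predU1P[/esym Ed|Ed].
      by rewrite Ed mulr0 add0r mulr_gt0 ?E12_gt0// divr_gt0.
    by rewrite ltr_wpDr ?mulr_gt0// mulr_ge0 ?E20// divr_ge0// ltW.
  rewrite (_ : l2 / 4 * E2 x d = l2 / 8 * E2 x d + l2 / 8 * E2 x d); last by field.
  move: (E1 x d) (lam * _) => e1 e2 h1 _ h2 h3.
  have : 0 <= l2 / 8 * E2 x d by rewrite mulr_ge0 ?E20// divr_ge0// ltW.
  move: h1 h3; move: (l2 / 8 * _) => e3; clear - h2; lra.
have [N NP] : exists N : nat, nu <= N%:R * l1.
  exists (Num.truncn (nu / l1)).+1.
  by rewrite -ler_pdivrMr//; exact/ltW/truncnS_gt.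
pose M (x : X) : 'M[R]_(n1 + n2) := (1 + V x) ^+ N *: block_mx (al *: M1 x) 0 0 (M2 x).
have bilM x u v : bil (M x) u v = (1 + V x) ^+ N *
    (al * bil (M1 x) (lsubmx u) (lsubmx v) + bil (M2 x) (rsubmx u) (rsubmx v)).
  by rewrite bilZ bil_block_diag bilZ.
have VC k : Ck_on U k V by exact: Ck_on_bil.
have MC k : Ck_on U k M.
  apply: Ck_on_scale => //.
    by apply: Ck_onX => //; apply: Ck_onD => //; exact: Ck_on_cst.
  by apply: Ck_on_block_diag => //; apply: Ck_on_scale => //; exact: Ck_on_cst.
have Mpos x : K x -> posdef (M x).
  move=> Kx; split=> [|d d0].
    rewrite /M linearZ/= tr_block_mx !trmx0 linearZ/=.
    by have [-> _] := pM1 x Kx; have [-> _] := pM2 x Kx.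
  rewrite -[qform _ _]/(bil _ _ _) bilM mulr_gt0 ?exprn_gt0 ?V1//.
  exact: S_gt0.
exists M, lam; split => //; first by split => //; exists U.
have arith (P a1 a2 b1 b2 b3 dr m s lm : R) :
    2 * (P * (al * a1 + (b1 + b2))) + (P * m + P * (al * a2 + (dr + b3))) + lm * (P * s) =
    P * (al * (2 * a1 + a2) + (2 * b2 + b3 + 2 * b1 + dr) + m + lm * s).
  by clear; ring.
have arith2 (t1 t2 c dr lS e1 e4 nV rQ h m : R) : t1 <= - (h + e1) ->
    t2 + (e4 + e4) <= rQ -> c - e4 <= h -> rQ + dr + lS - e1 - e4 <= nV ->
    m <= - nV -> t1 + (t2 + c + dr) + m + lS <= 0.
  by clear; move=> *; lra.
move=> x Kx d dMf; have [Msym _] := Mpos x Kx.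
have dfx : differentiable f x.
  by have [+ _] := Ck_on_row_mx Uo (sf1 1%N) (sf2 1%N); apply; exact: KU.
rewrite (qform_contraction_mx _ _ dfx Msym) derive_row_mx; last 2 first.
- exact: diff_derivable (df1 x Kx).
- exact: diff_derivable (df2 x Kx).
set w := f x; pose d1 := lsubmx d; pose d2 := rsubmx d.
have dd : d = inl d1 + inr d2 by rewrite -row_mx_sum hsubmxK.
have ww : w = inl (f1 x) + inr (f2 x) by rewrite -row_mx_sum.
have wl : lsubmx w = f1 x by rewrite row_mxKl.
pose ph := 1 + V x; have ph0 : 0 < ph := V1 x Kx.
have phN : 0 < ph ^+ N by rewrite exprn_gt0.
have constraint : bil (M2 x) d2 (f2 x) = - (al * bil (M1 x) d1 (f1 x)).
  move: dMf; rewrite -[LHS]/(bil (M x) d w) bilM wl row_mxKr => /eqP.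
  rewrite mulf_eq0 (gt_eqF phN)/= => /eqP h.
  by apply/eqP; rewrite -addr_eq0 addrC; apply/eqP.
pose DV := 2 * bil (M1 x) ('D_w f1 x) (f1 x) + bil ('D_w M1 x) (f1 x) (f1 x).
have dbil n (Q : X -> 'M[R]_n) (v : 'rV[R]_n) : differentiable Q x ->
    is_derive x w (fun y => bil (Q y) v v) (bil ('D_w Q x) v v).
  move=> /diff_derivable/derivableP dQ.
  have h := @is_derive_bil _ _ _ _ Q (fun=> v) (fun=> v) x w _ _ _ (dQ w)
    (is_derive_cst v x w) (is_derive_cst v x w).
  apply: is_derive_eq h _.
  by rewrite -addrA bil0l bil0r !addr0.
have dV : is_derive x w V DV.
  have h1 := derivableP (diff_derivable (v := w) (df1 x Kx)).
  have h2 := derivableP (diff_derivable (v := w) (dM1 x Kx)).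
  apply: is_derive_eq (is_derive_bil h2 h1 h1) _.
  by rewrite [bil (M1 x) (f1 x) _]bilC ?(pM1 x Kx).1// /DV; ring.
have DM : bil ('D_w M x) d d = N%:R * ph ^+ N.-1 * DV * S x d +
    ph ^+ N * (al * bil ('D_w M1 x) d1 d1 + bil ('D_w M2 x) d2 d2).
  have h := dbil _ M d ((MC 1%N).1 x (KU x Kx)).
  have h1 := dbil _ M1 d1 (dM1 x Kx); have h2 := dbil _ M2 d2 (dM2 x Kx).
  have E : (fun y => bil (M y) d d) = ((cst 1 + V) ^+ N) *
      (al \*: (fun y => bil (M1 y) d1 d1) + (fun y => bil (M2 y) d2 d2)).
    by apply/funext => y; rewrite bilM -/d1 -/d2 exprfctE.
  have [_ <-] := h; rewrite E; apply: derive_val.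
  apply: is_derive_eq; rewrite /GRing.scale/= add0r.
  rewrite exprfctE -[(cst 1 + V) x]/ph.
  rewrite -[(_ + _) x]/(S x d); ring.
rewrite DM !bilM row_mxKl row_mxKr -/ph -/d1 -/d2.
have -> : N%:R * ph ^+ N.-1 * DV * S x d = ph ^+ N * (N%:R * (DV / ph) * S x d).
  case: (N) => [|m]; first by rewrite !mul0r mulr0.
  by rewrite /= exprS; field; rewrite gt_eqF.
pose T1 := 2 * bil (M1 x) ('D_d f1 x) d1 + bil ('D_w M1 x) d1 d1.
have -> : bil (M2 x) ('D_d f2 x) d2 =
    bil (M2 x) ('D_(inl d1) f2 x) d2 + bil (M2 x) ('D_(inr d2) f2 x) d2.
  by rewrite {1}dd (deriveDdir _ _ (df2 x Kx)) bilDl.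
have -> : bil ('D_w M2 x) d2 d2 = drift x d + bil ('D_(inr (f2 x)) M2 x) d2 d2.
  by rewrite ww (deriveDdir _ _ (dM2 x Kx)) bilD.
suff : al * T1 + (T2 x d2 + cross x d + drift x d) + N%:R * (DV / ph) * S x d
    + lam * S x d <= 0.
  rewrite -(pmulr_rle0 _ phN); apply: le_trans.
  rewrite le_eqVlt; apply/orP; left; apply/eqP; exact: arith.
have t1 : al * T1 <= - ((kap + 1) * E1 x d).
  have -> : kap + 1 = al * l1 by rewrite /al divfK// gt_eqF.
  rewrite -mulrA -mulrN ler_wpM2l ?(ltW al0)//.
  by rewrite -subr_le0 opprK; exact: (contr1 x d Kx).
have t2 : T2 x d2 + l2 / 2 * E2 x d <= rho * (al * bil (M1 x) d1 (f1 x)) ^+ 2.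
  by have := rhoP x d2 Kx; rewrite constraint sqrrN.
have t3 := kapP x d Kx; have t4 := nuP x d Kx.
have t5 : N%:R * (DV / ph) * S x d <= - (nu * (V x / ph * S x d)).
  have DVle : DV <= - (l1 * V x).
    by rewrite -subr_le0 opprK /DV /V -wl; exact: (contr1 x w Kx).
  rewrite [X in _ <= - X]mulrA -mulNr ler_wpM2r ?S0// mulrA [X in _ <= - X]mulrA -mulNr.
  rewrite ler_pM2r ?invr_gt0//.
  apply: (@le_trans _ _ (N%:R * - (l1 * V x))); first by rewrite ler_wpM2l.
  by rewrite mulrN lerN2 mulrA ler_wpM2r ?V0.
move: t1 t2 t3 t4 t5; rewrite /g -/d1 -/ph.
rewrite (_ : l2 / 2 * E2 x d = l2 / 4 * E2 x d + l2 / 4 * E2 x d); last by field.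
rewrite mulrDl mul1r.
exact: arith2.
Qed.

End HierarchicalMetric.

(** * The theorem *)

Theorem theorem5 (R : realType) (n1 n2 : nat)
    (f1 : 'rV[R]_n1 -> 'rV[R]_n1)
    (f2 : 'rV[R]_n1 -> 'rV[R]_n2 -> 'rV[R]_n2)
    (K : set 'rV[R]_(n1 + n2))
    (K_nonempty : K !=set0)
    (K_compact : compact K)
    (K_connected : smoothly_path_connected K)
    (K_invariant : strictly_forward_invariant K (hierarchical f1 f2))
    (f1_smooth : smooth_near (lsubmx @` K) f1)
    (f2_smooth : smooth_near K (uncurry_row f2))
    (f2_transverse :
       exists (M2 : 'rV[R]_n1 -> 'rV[R]_n2 -> 'M[R]_n2) (lambda2 : R),
         [/\ 0 < lambda2,
             smooth_near K (uncurry_row M2),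
             forall x, K x -> posdef (M2 (lsubmx x) (rsubmx x)) &
             forall x, K x ->
               transverse_contraction_at (f2 (lsubmx x)) (M2 (lsubmx x))
                 lambda2 (rsubmx x)])
    (f1_contracting : strongly_contracting (lsubmx @` K) f1) :
  transverse_contracting K (hierarchical f1 f2) /\
  unique_stable_limit_cycle K (hierarchical f1 f2).
Proof.
have [M1 [l1 [l10 [[Um1 [oUm1 KUm1 sM1]] pM1] contr1]]] := f1_contracting.
have [M2 [l2 [l20 [Um2 [oUm2 KUm2 sM2]] pM2 contr2]]] := f2_transverse.
have [U1 [oU1 KU1 sf1]] := f1_smooth.
have [U2 [oU2 KU2 sf2]] := f2_smooth.
pose l : 'rV[R]_(n1 + n2) -> 'rV[R]_n1 := lsubmx.
have olU (W : set 'rV[R]_n1) : open W -> open (l @^-1` W).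
  by move=> oW; apply: open_comp => // x _; exact: continuous_lsubmx.
pose U := (l @^-1` U1 `&` l @^-1` Um1) `&` (U2 `&` Um2).
have oU : open U by apply: openI; apply: openI => //; exact: olU.
have KU : K `<=` U.
  move=> x Kx; split; split; [apply: KU1|apply: KUm1|exact: KU2|exact: KUm2];
    by exists x.
have Kl x : K x -> (lsubmx @` K) (lsubmx x) by move=> Kx; exists x.
have f1C k : Ck_on U k (fun x => f1 (lsubmx x)).
  apply: Ck_on_sub (Ck_on_linear_comp (L := lsubmx) oU1 _ (sf1 k)).
    by move=> x [[]].
  exact: continuous_lsubmx.
have M1C k : Ck_on U k (fun x => M1 (lsubmx x)).
  apply: Ck_on_sub (Ck_on_linear_comp (L := lsubmx) oUm1 _ (sM1 k)).
    by move=> x [[]].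
  exact: continuous_lsubmx.
have f2C k : Ck_on U k (uncurry_row f2).
  by apply: Ck_on_sub (sf2 k) => x [_ []].
have M2C k : Ck_on U k (uncurry_row M2).
  by apply: Ck_on_sub (sM2 k) => x [_ []].
have df1 x : K x -> differentiable f1 (lsubmx x).
  by move=> /Kl/KU1; exact: (sf1 1%N).1.
have df2 x : K x -> differentiable (f2 (lsubmx x)) (rsubmx x).
  by move=> /KU2 Ux; apply: differentiable_partial_r; exact: (sf2 1%N).1.
have tc : transverse_contracting K (hierarchical f1 f2).
  apply: (transverse_contracting_of_blocks (l1 := l1) (l2 := l2) K_compact oU KU
    f1C f2C M1C M2C) => //.
  - by move=> x /Kl; exact: pM1.
  - move=> x d Kx; have [M1sym _] := pM1 _ (Kl x Kx).
    have := contr1 _ (Kl x Kx) (lsubmx d).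
    rewrite (qform_contraction_mx _ _ (df1 x Kx) M1sym).
    by rewrite (derive_linear_comp f1 lsubmx) (derive_linear_comp M1 lsubmx)/= row_mxKl.
  - move=> x d2 Kx h; have [M2sym _] := pM2 x Kx.
    have := contr2 x Kx d2 h.
    rewrite (qform_contraction_mx _ _ (df2 x Kx) M2sym).
    by rewrite !derive_partial_r.
split => //; apply: transverse_contracting_limit_cycle => //.
by exists U; split => // k; exact: Ck_on_row_mx.
Qed.
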